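(* Let $(X,\omega)$ be a compact Kähler manifold with a Hamiltonian holomorphic isometric action of a compact torus $\mathbb{T}$, moment map $\mu$ and moment polytope $P$, and let $v\in C^\infty(P,\mathbb{R}_{>0})$. Suppose that $\omega$ is a $v$-soliton, i.e. $\mathrm{Ric}(\omega)-\omega=\frac{i}{2\pi}\partial\bar\partial\log v(\mu)$. Then the induced Hermitian metric $h_\omega=\frac12(g-\sqrt{-1}\omega)$ on $TX^{1,0}$ solves the $v$-weighted vortex equation $$\begin{cases}\bar\partial^{TX^{1,0}}\varphi=0,\\ i\left(\Lambda_\omega R_\omega+\langle\Phi_\omega,d(\log v)(\mu)\rangle\right)-\left\langle\varphi^\star\otimes\varphi,\mathrm{Hess}(\log v)(\mu)\right\rangle=2\pi\,\mathrm{Id}_{TX^{1,0}},\end{cases}$$ where $\varphi\in\Gamma(TX^{1,0})\otimes\mathfrak{t}^*$ is given by $\varphi(\xi)=\xi^{(1,0)}$ and $\varphi^\star\in\Gamma(T^*X^{1,0})\otimes\mathfrak{t}^*$ by $\varphi^\star(\xi)=h_\omega(-,\xi^{1,0})$.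
   Context: $\mathfrak{t}=\mathrm{Lie}(\mathbb{T})$; $\xi\in\mathfrak{t}$ is identified with the vector field it generates, and $\xi^{1,0}$ denotes its $(1,0)$-part; $d\langle\mu,\xi\rangle=\omega(-,\xi)$. $g$ is the Riemannian metric of $\omega$; $h_\omega$ is viewed on $TX^{1,0}$ via the isomorphism $TX\cong TX^{1,0}$, $V\mapsto V^{1,0}$. The Ricci form is normalised so that $\mathrm{Ric}(\omega)\in c_1(X)$. $R_\omega\in\Omega^2(\mathrm{End}(TX^{1,0}))$ is the curvature of the Chern (Levi-Civita) connection $\nabla$ of $h_\omega$ on $TX^{1,0}$, $\Lambda_\omega R_\omega=nR_\omega\wedge\omega^{n-1}/\omega^n$ with $n=\dim_{\mathbb{C}}X$, and $\Phi_\omega\in\Gamma(\mathfrak{t}^*\otimes\mathrm{End}(TX^{1,0}))$ is its moment map $\langle\Phi_\omega,\xi\rangle=\nabla_\xi-\mathcal{L}_\xi$, where $\mathcal{L}_\xi V=[\xi,V]$. $d(\log v)(p)\in\mathfrak{t}^{**}\cong\mathfrak{t}$ and $\mathrm{Hess}(\log v)(p)\in\mathfrak{t}\otimes\mathfrak{t}$; $\varphi^\star\otimes\varphi$ is the $\mathfrak{t}^*\otimes\mathfrak{t}^*$-valued section of $\mathrm{End}(TX^{1,0})$ whose value on $(\xi,\xi')$ is $s\mapsto h_\omega(s,\xi^{1,0})\,\xi'^{1,0}$, and $\langle-,-\rangle$ denotes the natural pairings. *)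

(* Defs.v *)
From mathcomp Require Import all_boot all_order all_algebra all_fingroup.
From mathcomp Require Import all_classical all_reals all_analysis.
From mathcomp Require Import complex.

Set Implicit Arguments.
Unset Strict Implicit.
Unset Printing Implicit Defensive.

Import Order.TTheory GRing.Theory Num.Theory numFieldNormedType.Exports.

Local Open Scope classical_set_scope.
Local Open Scope complex_scope.
Local Open Scope ring_scope.

(* [ndiff k U f]: [f] is [k] times differentiable on the open set [U].  In finite
   dimension being so for every [k] is the same as being C^infinity on [U]. *)
Fixpoint ndiff (R : realType) (V W : normedModType R) (k : nat)
    (U : set V) (f : V -> W) : Prop :=
  match k with
  | 0 => True
  | k'.+1 => (forall x, U x -> differentiable f x) /\
             (forall w, ndiff k' U (fun x => 'D_w f x))
  end.

Definition smooth_on (R : realType) (V W : normedModType R)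
    (U : set V) (f : V -> W) : Prop :=
  forall k, ndiff k U f.

(* C^infinity on an arbitrary set [P], for a function given together with an
   extension off [P]. *)
Definition smooth_near (R : realType) (V W : normedModType R)
    (P : set V) (f : V -> W) : Prop :=
  exists U : set V, [/\ open U, P `<=` U & smooth_on U f].

Notation model R n := ('rV[R]_n * 'rV[R]_n)%type.

Section Model.
Variables (R : realType) (n : nat).
Implicit Types (u w p : model R n) (f : model R n -> R[i]).

Definition Jop u : model R n := (- u.2, u.1).

Definition ddx (j : 'I_n) : model R n := (delta_mx 0 j, 0).
Definition ddy (j : 'I_n) : model R n := (0, delta_mx 0 j).

(* A tangent vector [u] is identified with its (1,0)-part [u^{1,0}], whose
   coordinates in the frame d/dz_1, ..., d/dz_n are [toC u]; thus
   (d/dx_j)^{1,0} = d/dz_j and (d/dy_j)^{1,0} = i d/dz_j. *)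
Definition toC u : 'rV[R[i]]_n := \row_j (u.1 0 j +i* u.2 0 j).
Definition ofC (s : 'rV[R[i]]_n) : model R n :=
  (\row_j complex.Re (s 0 j), \row_j complex.Im (s 0 j)).

Definition holomorphic_on (U : set (model R n)) (f : model R n -> model R n) :=
  smooth_on U f /\ forall p u, U p -> 'D_(Jop u) f p = Jop ('D_u f p).

Definition cD u f p : R[i] :=
  ('D_u (fun q => complex.Re (f q)) p) +i* ('D_u (fun q => complex.Im (f q)) p).

Definition dz (j : 'I_n) f p : R[i] := 2^-1 * (cD (ddx j) f p - 'i * cD (ddy j) f p).
Definition dzb (j : 'I_n) f p : R[i] := 2^-1 * (cD (ddx j) f p + 'i * cD (ddy j) f p).

(* The 2-form  d dbar f = sum_{j,k} (d/dz_j d/d(conj z_k) f) dz_j /\ d(conj z_k),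
   with (a /\ b)(u, w) = a(u) b(w) - a(w) b(u). *)
Definition ddbar (f : model R n -> R) p u w : R[i] :=
  \sum_j \sum_k dz j (dzb k (fun q => (f q)%:C)) p *
    (toC u 0 j * conjc (toC w 0 k) - toC w 0 j * conjc (toC u 0 k)).

(* The value of the 2n-form F_0 /\ ... /\ F_{n-1} on the frame
   d/dx_0, d/dy_0, ..., d/dx_{n-1}, d/dy_{n-1}. *)
Definition std_frame (a : 'I_n * bool) : model R n := if a.2 then ddy a.1 else ddx a.1.
Definition top_wedge (F : 'I_n -> model R n -> model R n -> R[i]) : R[i] :=
  (2 ^- n) * \sum_(s : {perm ('I_n * bool)%type}) (-1) ^+ s *
    \prod_(k < n) F k (std_frame (s (k, false))) (std_frame (s (k, true))).

(* Lambda_omega alpha = n alpha /\ omega^{n-1} / omega^n *)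
Definition Lambda_contr (omega alpha : model R n -> model R n -> R[i]) : R[i] :=
  n%:R * top_wedge (fun k => if k == 0%N :> nat then alpha else omega)
       / top_wedge (fun=> omega).

End Model.

Record complexManifold (R : realType) (n : nat) := ComplexManifold {
  cm_space :> topologicalType;
  cm_hausdorff : hausdorff_space cm_space;
  cm_second_countable : @second_countable cm_space;
  chart_index : Type;
  chart_dom : chart_index -> set cm_space;
  chart_map : chart_index -> cm_space -> model R n;
  chart_inv : chart_index -> model R n -> cm_space;
  chart_dom_open : forall i, open (chart_dom i);
  chart_dom_cover : forall x, exists i, chart_dom i x;
  chart_img_open : forall i, open (chart_map i @` chart_dom i);
  chart_mapK : forall i x, chart_dom i x -> chart_inv i (chart_map i x) = x;
  chart_map_continuous : forall i, {within chart_dom i, continuous (chart_map i)};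
  chart_inv_continuous : forall i, {within chart_map i @` chart_dom i, continuous (chart_inv i)};
  transition_holomorphic : forall i j,
    holomorphic_on [set p | (chart_map i @` chart_dom i) p /\ chart_dom j (chart_inv i p)]
                   (fun p => chart_map j (chart_inv i p))
}.

Definition chart_img (R : realType) (n : nat) (X : complexManifold R n)
    (i : chart_index X) : set (model R n) := chart_map i @` chart_dom i.

(* Tensor fields are given by their expressions in all charts: [kf i p u w] is the
   value of omega at the point [chart_inv i p] on the tangent vectors with
   coordinates [u] and [w]. *)
Record kahlerForm (R : realType) (n : nat) (X : complexManifold R n) := KahlerForm {
  kf :> chart_index X -> model R n -> model R n -> model R n -> R;
  kf_linear : forall i p a u u' w, chart_img i p ->
    kf i p (a *: u + u') w = a * kf i p u w + kf i p u' w;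
  kf_skew : forall i p u w, chart_img i p -> kf i p u w = - kf i p w u;
  kf_smooth : forall i u w, smooth_on (chart_img i) (fun p => kf i p u w);
  kf_compat : forall i j p u w, chart_img i p -> chart_dom j (chart_inv i p) ->
    let tau := fun q => chart_map j (chart_inv i q) in
    kf j (tau p) ('D_u tau p) ('D_w tau p) = kf i p u w;
  kf_J : forall i p u w, chart_img i p -> kf i p (Jop u) (Jop w) = kf i p u w;
  kf_positive : forall i p u, chart_img i p -> u != 0 -> 0 < kf i p u (Jop u);
  kf_closed : forall i p u w x, chart_img i p ->
    'D_u (fun q => kf i q w x) p + 'D_w (fun q => kf i q x u) p
      + 'D_x (fun q => kf i q u w) p = 0
}.

Section Hermitian.
Variables (R : realType) (n : nat) (X : complexManifold R n).
Variables (om : kahlerForm X) (i : chart_index X).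
Implicit Types (p u w : model R n).

Definition omC p u w : R[i] := (om i p u w)%:C.

Definition metric p u w : R := om i p u (Jop w).

(* h_omega = (g - i omega)/2, complex linear in the first argument. *)
Definition herm p (s t : 'rV[R[i]]_n) : R[i] :=
  2^-1 * ((metric p (ofC s) (ofC t))%:C - 'i * omC p (ofC s) (ofC t)).

Definition gram p : 'M[R[i]]_n :=
  \matrix_(j, k) herm p (delta_mx 0 j) (delta_mx 0 k).

(* omega = i sum_{j,k} gram_{jk} dz_j /\ d(conj z_k) and
   Ric(omega) = - (i/2pi) d dbar log det gram, which represents c_1(X). *)
Definition ricci p u w : R[i] :=
  - ('i / (2 * pi)%:C) * ddbar (fun q => ln (complex.Re (\det (gram q)))) p u w.

(* Sections of TX^{1,0} over the chart are functions [model R n -> 'rV[R[i]]_n]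
   (coordinates in the frame d/dz_j); endomorphisms are matrices acting on
   rows by right multiplication, so that row [j] is the image of d/dz_j. *)
Definition sD u (s : model R n -> 'rV[R[i]]_n) p : 'rV[R[i]]_n :=
  \row_k cD u (fun q => s q 0 k) p.

Definition endo_of_sections (A : (model R n -> 'rV[R[i]]_n) -> 'rV[R[i]]_n) :
  'M[R[i]]_n := \matrix_(j < n) A (fun=> delta_mx 0 j).

(* The Chern connection of [herm]: its connection form is (d^{1,0} H) H^-1, H = gram. *)
Definition chern_form p u : 'M[R[i]]_n :=
  (\sum_l toC u 0 l *: \matrix_(j, k) dz l (fun q => gram q j k) p)
    *m invmx (gram p).

Definition nabla u (s : model R n -> 'rV[R[i]]_n) p : 'rV[R[i]]_n :=
  sD u s p + s p *m chern_form p u.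

(* Constant vector fields commute, so R(u, w) = [nabla_u, nabla_w]. *)
Definition curvature p u w : 'M[R[i]]_n :=
  endo_of_sections (fun s => nabla u (nabla w s) p - nabla w (nabla u s) p).

Definition contracted_curvature p : 'M[R[i]]_n :=
  \matrix_(j, k) Lambda_contr (omC p) (fun u w => curvature p u w j k).

(* For a real vector field xi, the (1,0)-part of [xi, s]; the (0,1)-part vanishes
   when xi is holomorphic. *)
Definition lie_derivative (xi : model R n -> model R n)
    (s : model R n -> 'rV[R[i]]_n) p : 'rV[R[i]]_n :=
  sD (xi p) s p -
  \row_k \sum_l s p 0 l * dz l (fun q => toC (xi q) 0 k) p.

Definition connection_moment (xi : model R n -> model R n) p : 'M[R[i]]_n :=
  endo_of_sections (fun s => nabla (xi p) s p - lie_derivative xi s p).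

Definition rank_one p (a b : 'rV[R[i]]_n) : 'M[R[i]]_n :=
  endo_of_sections (fun s => herm p (s p) a *: b).

End Hermitian.

(* The Lie algebra t of T = R^r / Z^r is 'rV[R]_r, and its dual is 'rV[R]_r through
   [pairing].  An action of T is given through the covering t -> T, as an action of
   t whose restriction to the lattice Z^r is trivial. *)
Definition pairing (R : realType) (r : nat) (q xi : 'rV[R]_r) : R :=
  \sum_a q 0 a * xi 0 a.

Record torusAction (R : realType) (n r : nat) (X : complexManifold R n) := TorusAction {
  torus_act :> 'rV[R]_r -> X -> X;
  torus_act0 : forall x, torus_act 0 x = x;
  torus_actD : forall s t x, torus_act (s + t) x = torus_act s (torus_act t x);
  torus_act_lattice : forall (k : 'rV[int]_r) x, torus_act (map_mx intr k) x = x;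
  torus_act_continuous : continuous (fun z : 'rV[R]_r * X => torus_act z.1 z.2);
  torus_act_smooth : forall i j,
    smooth_on [set z : 'rV[R]_r * model R n |
                 chart_img i z.2 /\ chart_dom j (torus_act z.1 (chart_inv i z.2))]
              (fun z => chart_map j (torus_act z.1 (chart_inv i z.2)))
}.

Section TorusActions.
Variables (R : realType) (n r : nat) (X : complexManifold R n).
Variables (om : kahlerForm X) (T : torusAction r X).

Definition holomorphic_action : Prop := forall t i j,
  holomorphic_on [set p | chart_img i p /\ chart_dom j (T t (chart_inv i p))]
                 (fun p => chart_map j (T t (chart_inv i p))).

Definition isometric_action : Prop := forall t i j p u w,
  chart_img i p -> chart_dom j (T t (chart_inv i p)) ->
  let f := fun q => chart_map j (T t (chart_inv i q)) in
  metric om j (f p) ('D_u f p) ('D_w f p) = metric om i p u w.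

Definition fundamental (xi : 'rV[R]_r) (i : chart_index X) (p : model R n) : model R n :=
  derive1 (fun s : R => chart_map i (T (s *: xi) (chart_inv i p))) 0.

(* d<mu, xi> = omega(-, xi); invariance of [mu] under T is a consequence. *)
Definition moment_map (mu : X -> 'rV[R]_r) : Prop :=
  (forall i, smooth_on (chart_img i) (fun p => mu (chart_inv i p))) /\
  (forall (xi : 'rV[R]_r) i p u, chart_img i p ->
     'D_u (fun q => pairing (mu (chart_inv i q)) xi) p = om i p u (fundamental xi i p)).

(* For connected [X] this is a convex polytope (Atiyah, Guillemin-Sternberg). *)
Definition moment_polytope (mu : X -> 'rV[R]_r) : set 'rV[R]_r := range mu.

Definition v_soliton (mu : X -> 'rV[R]_r) (v : 'rV[R]_r -> R) : Prop :=
  forall i p u w, chart_img i p ->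
    ricci om i p u w - omC om i p u w =
    'i / (2 * pi)%:C * ddbar (fun q => ln (v (mu (chart_inv i q)))) p u w.

Definition phi (xi : 'rV[R]_r) (i : chart_index X) (p : model R n) : 'rV[R[i]]_n :=
  toC (fundamental xi i p).

Definition Phi (xi : 'rV[R]_r) (i : chart_index X) (p : model R n) : 'M[R[i]]_n :=
  connection_moment om i (fundamental xi i) p.

(* The value of phi^* (x) phi on (xi, xi'). *)
Definition phi_star_phi (xi xi' : 'rV[R]_r) (i : chart_index X) (p : model R n) :
  'M[R[i]]_n := rank_one om i p (phi xi i p) (phi xi' i p).

End TorusActions.

Definition unit_vec (R : realType) (r : nat) (a : 'I_r) : 'rV[R]_r := delta_mx 0 a.

Definition grad (R : realType) (r : nat) (f : 'rV[R]_r -> R) (q : 'rV[R]_r) : 'rV[R]_r :=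
  \row_a 'D_(unit_vec R a) f q.

Definition hess (R : realType) (r : nat) (f : 'rV[R]_r -> R) (q : 'rV[R]_r) : 'M[R]_r :=
  \matrix_(a, b) 'D_(unit_vec R a) (fun q' => 'D_(unit_vec R b) f q') q.

(* Main.v *)
Require Import Defs.
From mathcomp Require Import all_boot all_order all_algebra all_fingroup.
From mathcomp Require Import all_classical all_reals all_analysis.
From mathcomp Require Import complex ring lra.
Import Order.TTheory GRing.Theory Num.Theory numFieldNormedType.Exports.
Local Open Scope classical_set_scope.
Local Open Scope complex_scope.
Local Open Scope ring_scope.
Set Implicit Arguments.
Unset Strict Implicit.
Unset Printing Implicit Defensive.

(** The statement is local, and in a chart it is an identity between matrices.
    Let [H] be the Gram matrix of the metric in the frame d/dz_j, so that
    omega = i sum_(j,k) H_jk dz_j /\ d(conj z_k), and let A_l = d_l H H^-1 be the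
    coefficients of the Chern connection.

    The curvature has type (1,1), with coefficients - d(conj z)_m A_l
    ([curvature_form11]), and on forms of that type Lambda_omega is - i times the
    trace against H^-1 ([Lambda_contr_form11]).  Because omega is closed,
    d_l H_ac is symmetric in l and a ([dz_gram_sym]).  Hence contracting the
    curvature on its form indices or on its endomorphism indices gives the same
    result, and the latter contraction is the derivative of log det H:
    i Lambda_omega R = Ric H^-1, where Ric_jk = - d_j d(conj z)_k log det H
    ([contracted_curvatureE]).

    The soliton equation says Ric = 2 pi H + (d_j d(conj z)_k log v(mu))
    ([soliton_ricci_mx]), so i Lambda_omega R = 2 pi + (d dbar log v(mu)) H^-1.
    By the chain rule the last matrix has two parts ([potential_hess_mulG]).
    Since d mu_a = omega(-, xi_a), the first derivatives of mu are
    d_j mu_a = i h(d/dz_j, xi_a) and d(conj z)_k mu_a = - i sum_l H_lk xi_a^l, and their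
    products pair with Hess(log v) into phi^* (x) phi.  The second derivatives of mu
    are obtained by differentiating the latter formula; raising an index turns
    them into - i (A(xi_a) + d xi_a) = - i Phi_a, which pairs with d(log v).
    Both parts are exactly the terms that the vortex equation moves to the left.

    The equation dbar phi = 0 holds because the flow acts by holomorphic maps and
    the derivative in time commutes with those in space ([phi_holomorphic]), by
    Schwarz's theorem ([schwarz]). *)

(** * Determinants over a finite index type *)

Section FiniteDeterminant.
Variables (F : fieldType) (A : finType).
Implicit Types (M P : A -> A -> F) (f : A -> A).

(** The slots of a top-degree form on a complex [n]-space are indexed by
    ['I_n * bool]; summing over permutations of that type avoids numbering it. *)
Definition fdet M : F := \sum_(s : {perm A}) (-1) ^+ s * \prod_a M a (s a).

Lemma fdet_ext M M' : (forall a b, M a b = M' a b) -> fdet M = fdet M'.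
Proof.
by move=> e; apply: eq_bigr => s _; congr (_ * _); apply: eq_bigr => a _.
Qed.

Lemma fdet_rows (t : {perm A}) M :
  fdet (fun a => M (t a)) = (-1) ^+ t * fdet M.
Proof.
rewrite /fdet (reindex_inj (mulgI t)) big_distrr /=; apply: eq_bigr => s _.
rewrite odd_permM signr_addb -mulrA; congr (_ * (_ * _)).
rewrite [RHS](reindex_inj (@perm_inj _ t)) /=.
by apply: eq_bigr => a _; rewrite permM.
Qed.

Lemma fdet_alternate M a1 a2 : a1 != a2 -> (forall b, M a1 b = M a2 b) -> fdet M = 0.
Proof.
move=> a12 e; rewrite /fdet (bigID (fun s : {perm A} => ~~ odd_perm s)) /=.
rewrite [X in _ + X](reindex_inj (mulgI (tperm a1 a2))) /=.
rewrite [X in _ + X](eq_bigl (fun s : {perm A} => ~~ odd_perm s)); last first.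
  by move=> s; rewrite odd_permM odd_tperm a12 addTb negbK.
rewrite -big_split big1 //= => s es.
rewrite odd_permM odd_tperm a12 addTb (negbTE es) expr0 expr1.
rewrite [X in _ + -1 * X](reindex_inj (@perm_inj _ (tperm a1 a2))) /=.
rewrite mulN1r mul1r; apply/eqP; rewrite subr_eq0; apply/eqP.
apply: eq_bigr => a _; rewrite permM tpermK.
by case: tpermP => [->|->|].
Qed.

(** Multilinearity in the rows: the half of [det (P M) = det P * det M] that
    nonvanishing needs. *)
Lemma fdet_expand P M :
  fdet (fun a b => \sum_c P a c * M c b) =
  \sum_(f : {ffun A -> A}) (\prod_a P a (f a)) * fdet (fun a => M (f a)).
Proof.
rewrite /fdet; under [RHS]eq_bigr do rewrite big_distrr /=.
rewrite exchange_big /=; apply: eq_bigr => s _.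
rewrite bigA_distr_bigA big_distrr /=; apply: eq_bigr => f _.
by rewrite mulrCA big_split.
Qed.

Lemma fdet_id : fdet (fun a b => (a == b)%:R) = 1.
Proof.
rewrite /fdet (bigD1 1%g) //= odd_perm1 expr0 mul1r big1 => [|a _]; last first.
  by rewrite perm1 eqxx.
rewrite big1 ?addr0 // => s s1.
have [a sa] : exists a, s a != a.
  apply/existsP; apply: contraNT s1; rewrite negb_exists => /forallP e.
  by apply/eqP/permP => a; rewrite perm1; apply/eqP; rewrite -[_ == _]negbK.
by rewrite (bigD1 a) //= eq_sym (negbTE sa) mul0r mulr0.
Qed.

(** Each row family occurring in the expansion of [P M] is a permutation of the
    rows of [M] or has a repeated row, so [fdet M = 0] would force [fdet 1 = 0]. *)
Lemma fdet_neq0 P M :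
  (forall a b, \sum_c P a c * M c b = (a == b)%:R) -> fdet M != 0.
Proof.
move=> e; apply/eqP => M0; have := oner_neq0 F; apply/negP; rewrite negbK.
rewrite -fdet_id -(fdet_ext e) fdet_expand big1 // => f _.
case: (boolP (injectiveb f)) => [/injectiveP inj_f|/injectivePn [a [b ab fab]]].
  rewrite [fdet _](_ : _ = fdet (fun a => M (perm inj_f a))).
    by rewrite fdet_rows M0 !mulr0.
  by apply: fdet_ext => a b; rewrite permE.
by rewrite (fdet_alternate ab) ?mulr0 // => c; rewrite fab.
Qed.
End FiniteDeterminant.

(** * Wedge products of 2-forms *)

Section Mixed.
Variables (F : fieldType) (n : nat).
Let A : finType := ('I_n * bool)%type.
Variables th tb : 'I_n -> A -> F.

(** The wedge product of the bilinear forms [b k], evaluated on a frame indexed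
    by ['I_n * bool] but without antisymmetrising each factor first. *)
Definition wsum (b : 'I_n -> A -> A -> F) : F :=
  \sum_(s : {perm A}) (-1) ^+ s * \prod_k b k (s (k, false)) (s (k, true)).

Lemma wsum_ext b b' : (forall k x y, b k x y = b' k x y) -> wsum b = wsum b'.
Proof.
by move=> e; apply: eq_bigr => s _; congr (_ * _); apply: eq_bigr => k _.
Qed.

(** Exchanging the two arguments of the [k0]-th factor is a transposition of the
    frame, so the two halves of an antisymmetrised factor contribute equally. *)
Lemma wsum_antisym1 b b' k0 :
  (forall k, k != k0 -> forall x y, b k x y = b' k x y) ->
  (forall x y, b' k0 x y = b k0 x y - b k0 y x) ->
  wsum b' = 2 * wsum b.
Proof.
move=> e e0.
pose t : {perm A} := tperm (k0, false) (k0, true).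
have tk k c : k != k0 -> t (k, c) = (k, c).
  by move=> kk; rewrite tpermD //; apply: contra kk => /eqP [->].
have odd_t : odd_perm t by rewrite odd_tperm xpair_eqE eqxx.
have -> : wsum b' = wsum b -
   \sum_(s : {perm A}) (-1) ^+ s * (b k0 (s (k0, true)) (s (k0, false)) *
     \prod_(k | k != k0) b k (s (k, false)) (s (k, true))).
  rewrite /wsum -sumrB; apply: eq_bigr => s _.
  rewrite (bigD1 k0) //= [in RHS](bigD1 k0) //= e0 -mulrBr; congr (_ * _).
  rewrite mulrBl; congr (_ * _ - _ * _); apply: eq_bigr => k kk; exact/esym/e.
rewrite mulr2n mulrDl mul1r; congr (_ + _); rewrite -sumrN.
rewrite (reindex_inj (mulgI t)); apply: eq_bigr => s _.
rewrite odd_permM odd_t signr_addb expr1 mulN1r mulNr opprK.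
congr (_ * _); rewrite [RHS](bigD1 k0) //= !permM tpermL tpermR; congr (_ * _).
by apply: eq_bigr => k kk; rewrite !permM !tk.
Qed.

Lemma wsum_antisym b :
  wsum (fun k x y => b k x y - b k y x) = 2 ^+ n * wsum b.
Proof.
(* The factors of index below [m] have already been replaced. *)
pose c (m : nat) (k : 'I_n) x y := if (k < m)%N then b k x y else b k x y - b k y x.
suff H m : (m <= n)%N -> wsum (c 0) = 2 ^+ m * wsum (c m).
  transitivity (wsum (c 0)); first exact: wsum_ext.
  rewrite (H n (leqnn n)); congr (_ * _); apply: wsum_ext => k x y.
  by rewrite /c ltn_ord.
elim: m => [|m IH] mn; first by rewrite mul1r.
rewrite IH ?(ltnW mn) // exprSr -mulrA; congr (_ * _).
apply: (@wsum_antisym1 _ _ (Ordinal mn)) => [k kk x y|x y]; rewrite /c /=.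
  by rewrite ltnS leq_eqVlt -(inj_eq val_inj) /= in kk *; rewrite (negbTE kk).
by rewrite ltnn ltnS leqnn.
Qed.

(** The rows of the determinant attached to the decomposable form
    th_(l 0) /\ tb_(m 0) /\ th_(l 1) /\ tb_(m 1) /\ ... *)
Definition slots (l m : 'I_n -> 'I_n) (a : A) : A -> F :=
  if a.2 then tb (m a.1) else th (l a.1).

Lemma prod_slots l m (x : A -> A) :
  \prod_a slots l m a (x a) =
  \prod_k (th (l k) (x (k, false)) * tb (m k) (x (k, true))).
Proof.
rewrite (eq_bigr (fun a : A => slots l m (a.1, a.2) (x (a.1, a.2)))); last by case.
rewrite -(pair_big predT predT (fun k c => slots l m (k, c) (x (k, c)))) /=.
by apply: eq_bigr => k _; rewrite big_bool mulrC.
Qed.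

Lemma wsum_expand (B : 'I_n -> 'I_n -> 'I_n -> F) :
  wsum (fun k x y => \sum_l \sum_m B k l m * (th l x * tb m y)) =
  \sum_(f : {ffun 'I_n -> 'I_n * 'I_n})
    (\prod_k B k (f k).1 (f k).2) * fdet (slots (fst \o f) (snd \o f)).
Proof.
rewrite /wsum /fdet; under [RHS]eq_bigr do rewrite big_distrr /=.
rewrite exchange_big /=; apply: eq_bigr => s _.
under eq_bigr do rewrite pair_bigA /=.
rewrite bigA_distr_bigA big_distrr /=; apply: eq_bigr => f _.
by rewrite mulrCA prod_slots big_split.
Qed.

Lemma slots_alternate l m : ~~ (injectiveb l && injectiveb m) -> fdet (slots l m) = 0.
Proof.
rewrite negb_and => /orP [|] /injectivePn [j [k jk e]].
  apply: (@fdet_alternate _ _ _ (j, false) (k, false)).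
    by apply: contra jk => /eqP [->].
  by move=> b; rewrite /slots /= e.
apply: (@fdet_alternate _ _ _ (j, true) (k, true)).
  by apply: contra jk => /eqP [->].
by move=> b; rewrite /slots /= e.
Qed.

(** Permuting the [n] factors moves the pairs (th, tb) together, which is an even
    permutation of the [2n] rows. *)
Lemma slots_perm (s : 'S_n) l : fdet (slots (l \o s) (l \o s)) = fdet (slots l l).
Proof.
have [ts -> _] := prod_tpermP s; elim: ts l => [|t ts IH] l /=.
  rewrite big_nil; apply: fdet_ext => a b.
  by rewrite /slots /= perm1.
rewrite big_cons -[RHS]IH; set u := (\prod_(i <- ts) _)%g.
pose p : {perm A} := (tperm (t.1, false) (t.2, false) * tperm (t.1, true) (t.2, true))%g.
have pE a : p a = (tperm t.1 t.2 a.1, a.2).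
  have same (c : bool) k : tperm (t.1, c) (t.2, c) (k, c) = (tperm t.1 t.2 k, c) :> A.
    by rewrite -(inj_tperm (f := fun k => (k, c))) // => x y [].
  have other (c : bool) k : tperm (t.1, c) (t.2, c) (k, ~~ c) = (k, ~~ c) :> A.
    by rewrite tpermD // xpair_eqE; case: c; rewrite andbF.
  case: a => k []; rewrite /p permM.
    by rewrite (other false) (same true).
  by rewrite (same false) (other true).
transitivity (fdet (fun a => slots (l \o u) (l \o u) (p a))).
  by apply: fdet_ext => a b; rewrite pE /slots /= permM.
rewrite fdet_rows odd_permM !odd_tperm !xpair_eqE !andbT.
by rewrite addbb mul1r.
Qed.

(** All factors but the [k0]-th are sum_l th_l /\ tb_l.  A term survives only if
    [l] and [m] are permutations; they agree away from [k0], hence also at [k0],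
    and only diagonal coefficients of [N] remain. *)
Lemma wsum_trace (N : 'I_n -> 'I_n -> F) k0 :
  wsum (fun k x y => \sum_l \sum_m (if k == k0 then N l m else (l == m)%:R) *
                     (th l x * tb m y)) =
  fdet (slots id id) * \sum_(s : 'S_n) N (s k0) (s k0).
Proof.
rewrite (wsum_expand (fun k l m => if k == k0 then N l m else (l == m)%:R)).
rewrite (bigID (fun f : {ffun 'I_n -> 'I_n * 'I_n} =>
   injectiveb (fst \o f) && [forall k, (f k).1 == (f k).2])) /= [X in _ + X]big1 ?addr0.
  pose h (s : 'S_n) : {ffun 'I_n -> 'I_n * 'I_n} := [ffun k => (s k, s k)].
  pose h' (f : {ffun 'I_n -> 'I_n * 'I_n}) : 'S_n :=
    insubd (1%g : 'S_n) [ffun k => (f k).1].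
  have h'K (f : {ffun 'I_n -> 'I_n * 'I_n}) : injectiveb (fst \o f) -> forall k, h' f k = (f k).1.
    move=> /injectiveP inj_f k; rewrite /h' unlock insubdK ?ffunE //.
    rewrite unfold_in; apply/injectiveP => a b; rewrite !ffunE; exact: inj_f.
  rewrite (reindex h) /=; last first.
    exists h' => [s _|f].
      apply/permP => k; rewrite h'K ?ffunE //.
      by apply/injectiveP => a b /=; rewrite !ffunE; exact: perm_inj.
    rewrite inE => /andP [inj_f /forallP fE]; apply/ffunP => k.
    by rewrite ffunE h'K //= [f k]surjective_pairing (eqP (fE k)).
  rewrite mulrC big_distrl /=; apply: eq_big => [s|s _].
    apply/andP; split; last by apply/forallP => k; rewrite !ffunE.
    by apply/injectiveP => a b /=; rewrite !ffunE; exact: perm_inj.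
  congr (_ * _).
    rewrite (bigD1 k0) //= eqxx ffunE big1 ?mulr1 // => k kk.
    by rewrite (negbTE kk) ffunE eqxx.
  rewrite -(slots_perm s); apply: fdet_ext => a b.
  by rewrite /slots /= !ffunE.
move=> f nf; case: (boolP (injectiveb (fst \o f) && injectiveb (snd \o f))); last first.
  by move=> /slots_alternate ->; rewrite mulr0.
move=> /andP [if1 if2]; rewrite if1 /= negb_forall in nf.
have [/forallP e|] := boolP [forall k, (k != k0) ==> ((f k).1 == (f k).2)]; last first.
  rewrite negb_forall => /existsP [k]; rewrite negb_imply => /andP [kk fk].
  by rewrite (bigD1 k) //= (negbTE kk) (negbTE fk) !mul0r.
case/existsP: nf => k; have := e k; case: eqVneq => /= [->|_ /eqP ->]; last by rewrite eqxx.
move=> _ /negP []; apply/eqP.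
have /injectiveP i1 := if1; have /injectiveP i2 := if2.
have [g _ gK] := injF_bij i2.
have := gK (f k0).1; case: (eqVneq (g (f k0).1) k0) => [->|gk] /= gE; first by rewrite -gE.
have /implyP /(_ gk) /eqP := e (g (f k0).1); rewrite gE => /i1 ek.
by rewrite ek eqxx in gk.
Qed.

(** The sum does not depend on [k0], so it may be averaged over [k0]. *)
Lemma sum_perm_trace (N : 'I_n -> 'I_n -> F) k0 :
  n%:R * (\sum_(s : 'S_n) N (s k0) (s k0)) =
  (\sum_k N k k) * (\sum_(s : 'S_n) 1).
Proof.
have H k : \sum_(s : 'S_n) N (s k) (s k) = \sum_(s : 'S_n) N (s k0) (s k0).
  rewrite (reindex_inj (mulgI (tperm k k0))) /=.
  by apply: eq_bigr => s _; rewrite permM tpermL.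
transitivity (\sum_k \sum_(s : 'S_n) N (s k) (s k)).
  rewrite [RHS](eq_bigr _ (fun k _ => H k)).
  by rewrite sumr_const card_ord mulr_natl.
rewrite exchange_big big_distrr /=; apply: eq_bigr => s _.
by rewrite mulr1 [RHS](reindex_inj (@perm_inj _ s)).
Qed.
End Mixed.

(** * Contraction of (1,1)-forms *)

Section Contraction.
Variables (R : realType) (n : nat).
Local Notation C := R[i].
Implicit Types (H G rho : 'M[C]_n).

Lemma mulii : 'i * 'i = -1 :> C.
Proof. by rewrite -expr2 sqr_i. Qed.

Lemma conjci : conjc 'i = - 'i :> C.
Proof. by apply/eqP; rewrite eq_complex /= oppr0 !eqxx. Qed.

Lemma conjcD (x y : C) : conjc (x + y) = conjc x + conjc y.
Proof. exact: rmorphD. Qed.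
Lemma conjcM (x y : C) : conjc (x * y) = conjc x * conjc y.
Proof. exact: rmorphM. Qed.
Lemma conjcB (x y : C) : conjc (x - y) = conjc x - conjc y.
Proof. exact: rmorphB. Qed.
Lemma conjc_half : conjc (2^-1) = 2^-1 :> C.
Proof. by rewrite conjc_inv conjc_nat. Qed.
Lemma conjcR (x : R) : conjc x%:C = x%:C.
Proof. exact: conjc_real. Qed.

(** The form sum_(l,m) rho_lm dz_l /\ d(conj z_m). *)
Definition form11 rho (u w : model R n) : C :=
  \sum_l \sum_m rho l m *
    (toC u 0 l * conjc (toC w 0 m) - toC w 0 l * conjc (toC u 0 m)).

Lemma toC_std_frame (a : 'I_n * bool) (l : 'I_n) :
  toC (std_frame R a) 0 l = (l == a.1)%:R * (if a.2 then 'i else 1).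
Proof.
case: a => j []; rewrite /std_frame /ddx /ddy mxE /= !mxE eqxx /=;
  by case: (l == j); apply/eqP; rewrite eq_complex /= ?mulr0 ?mulr1 ?mul0r ?subr0 ?addr0 !eqxx.
Qed.

Definition dz_frame (l : 'I_n) (a : 'I_n * bool) : C := toC (std_frame R a) 0 l.
(** The forms theta_l for which i sum_(l,m) H_lm dz_l /\ d(conj z_m) equals
    sum_l dz_l /\ theta_l. *)
Definition dual_frame H (l : 'I_n) (a : 'I_n * bool) : C :=
  'i * \sum_m H l m * conjc (dz_frame m a).

Lemma dual_frameK H G (m : 'I_n) a : G *m H = 1%:M ->
  \sum_j - 'i * G m j * dual_frame H j a = conjc (dz_frame m a).
Proof.
move=> GH; transitivity (\sum_k (G *m H) m k * conjc (dz_frame k a)).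
  under [RHS]eq_bigr => k _ do rewrite mxE big_distrl /=.
  rewrite exchange_big /=; apply: eq_bigr => j _.
  rewrite /dual_frame mulrACA mulNr mulii opprK mul1r.
  by rewrite big_distrr /=; apply: eq_bigr => k _; rewrite mulrA.
rewrite GH (bigD1 m) //= !mxE eqxx mul1r big1 ?addr0 // => k km.
by rewrite !mxE eq_sym (negbTE km) mul0r.
Qed.

(** The dz_l and theta_l form a basis: dx_k = (dz_k + d(conj z_k)) / 2 and
    dy_k = - i (dz_k - d(conj z_k)) / 2 express the dual frame through them. *)
Lemma fdet_dual_frame H G : G *m H = 1%:M ->
  fdet (slots dz_frame (dual_frame H) id id) != 0.
Proof.
move=> GH.
pose P (a c : 'I_n * bool) : C :=
  2^-1 * (if c.2 then (if a.2 then 1 else - 'i) * G a.1 c.1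
          else (if a.2 then - 'i else 1) * (a.1 == c.1)%:R).
apply: (@fdet_neq0 _ _ P) => -[k c] b.
rewrite -(pair_bigA _ (fun j d => P (k, c) (j, d) * slots dz_frame (dual_frame H) id id (j, d) b)) /=.
under eq_bigr do rewrite big_bool /=.
rewrite big_split /=.
have -> : \sum_j P (k, c) (j, true) * slots dz_frame (dual_frame H) id id (j, true) b =
   2^-1 * (if c then 'i else 1) * conjc (dz_frame k b).
  rewrite -(dual_frameK _ _ GH) big_distrr /=; apply: eq_bigr => j _.
  rewrite /P /slots /=; case: c.
    by rewrite -!mulrA; congr (_ * _); rewrite mul1r [RHS]mulrA mulrN mulii opprK mul1r.
  by rewrite -!mulrA mul1r.
rewrite (bigD1 k) //= big1 ?addr0 => [|j jk]; last first.
  by rewrite /P /= eq_sym (negbTE jk) !mulr0 mul0r.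
rewrite /P /slots /= eqxx /dz_frame !toC_std_frame.
rewrite rmorphM /= conjc_nat mulr1.
have -> : conjc (if b.2 then 'i else 1) = (if b.2 then - 'i else 1) :> C.
  by case: ifP; rewrite ?conjci ?conjc1.
case: b => j d /=; rewrite xpair_eqE; case: (k == j); last first.
  by rewrite !mul0r !mulr0 addr0.
rewrite !mul1r -!mulrA -mulrDr; case: c; case: d; rewrite ?mulr1 ?mul1r.
- by rewrite mulrN mulNr mulii opprK mulVf // pnatr_eq0.
- by rewrite subrr mulr0.
- by rewrite addrC subrr mulr0.
- by rewrite mulVf // pnatr_eq0.
Qed.

(** With omega = sum_l dz_l /\ theta_l and alpha = sum_(l,m) N_lm dz_l /\ theta_m,
    only the trace of [N = - i rho G] contributes to alpha /\ omega^(n-1). *)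
Lemma Lambda_contr_form11 H G rho (om al : model R n -> model R n -> C) :
  G *m H = 1%:M ->
  (forall u w, om u w = 'i * form11 H u w) ->
  (forall u w, al u w = form11 rho u w) ->
  Lambda_contr om al = - 'i * \sum_l \sum_m rho l m * G m l.
Proof.
move=> GH omE alE; case: (posnP n) => [n0|n_gt0].
  rewrite /Lambda_contr [n%:R](_ : _ = 0) ?n0 // !mul0r big1 ?mulr0 // => -[l ln].
  by exfalso; rewrite n0 in ln.
pose k0 := Ordinal n_gt0.
pose th := @dz_frame; pose tb := dual_frame H.
pose N l j : C := \sum_m rho l m * (- 'i * G m j).
pose b (Nk : 'I_n -> 'I_n -> C) (x y : 'I_n * bool) :=
  \sum_l \sum_m Nk l m * (dz_frame l x * tb m y).
have form_b rh x y :
   form11 rh (std_frame R x) (std_frame R y) =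
   \sum_l \sum_m rh l m * (dz_frame l x * conjc (dz_frame m y)) -
   \sum_l \sum_m rh l m * (dz_frame l y * conjc (dz_frame m x)).
  rewrite /form11 -sumrB; apply: eq_bigr => l _; rewrite -sumrB.
  by apply: eq_bigr => m _; rewrite mulrBr.
have omb x y : om (std_frame R x) (std_frame R y) =
    b (fun l m => (l == m)%:R) x y - b (fun l m => (l == m)%:R) y x.
  have bE x' y' : b (fun l m => (l == m)%:R) x' y' =
      'i * (\sum_l \sum_m H l m * (dz_frame l x' * conjc (dz_frame m y'))).
    rewrite big_distrr; apply: eq_bigr => l _ /=.
    rewrite (bigD1 l) //= eqxx mul1r big1 ?addr0; last first.
      by move=> m ml; rewrite eq_sym (negbTE ml) mul0r.
    rewrite /tb /dual_frame mulrCA big_distrr; congr (_ * _); apply: eq_bigr => m _ /=.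
    by rewrite mulrCA.
  by rewrite omE form_b mulrBr -!bE.
have alb x y : al (std_frame R x) (std_frame R y) = b N x y - b N y x.
  have bE x' y' : b N x' y' =
      \sum_l \sum_m rho l m * (dz_frame l x' * conjc (dz_frame m y')).
    apply: eq_bigr => l _; rewrite /N.
    under eq_bigr => j _ do rewrite big_distrl /=.
    rewrite exchange_big; apply: eq_bigr => m _ /=.
    rewrite -(dual_frameK _ _ GH) -/tb !big_distrr; apply: eq_bigr => j _ /=.
    by rewrite -!mulrA; congr (_ * _); rewrite ![_ * (dz_frame _ _ * _)]mulrCA [dz_frame _ _ * _]mulrCA.
  by rewrite alE form_b !bE.
have topE Nk (al' : model R n -> model R n -> C) :
   (forall x y, al' (std_frame R x) (std_frame R y) = b Nk x y - b Nk y x) ->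
   top_wedge (fun k => if k == 0%N :> nat then al' else om) =
   fdet (slots (@dz_frame) tb id id) * \sum_(s : 'S_n) Nk (s k0) (s k0).
  move=> al'E; rewrite -wsum_trace.
  apply: (mulfI (x := 2 ^+ n)); first by rewrite expf_neq0 // pnatr_eq0.
  rewrite -wsum_antisym mulrA mulfV ?mul1r ?expf_neq0 ?pnatr_eq0 //.
  apply: eq_bigr => s _; congr (_ * _); apply: eq_bigr => k _.
  have -> : (k == 0%N :> nat) = (k == k0) by [].
  by case: eqVneq => _; rewrite ?al'E ?omb.
rewrite /Lambda_contr (topE N al alb).
have -> : top_wedge (fun _ : 'I_n => om) =
   fdet (slots (@dz_frame) tb id id) * \sum_(s : 'S_n) 1.
  rewrite -[RHS](_ : fdet (slots (@dz_frame) tb id id) *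
     \sum_(s : 'S_n) ((fun l m : 'I_n => (l == m)%:R) (s k0) (s k0)) = _).
    rewrite -(topE _ om omb) /top_wedge; congr (_ * _); apply: eq_bigr => s _.
    by congr (_ * _); apply: eq_bigr => k _; case: ifP.
  by congr (_ * _); apply: eq_bigr => s _; rewrite eqxx.
have c0 : fdet (slots (@dz_frame) tb id id) != 0 := fdet_dual_frame GH.
have s0 : \sum_(s : 'S_n) (1 : C) != 0.
  rewrite sumr_const pnatr_eq0 -lt0n; apply/card_gt0P.
  by exists 1%g.
rewrite mulrCA sum_perm_trace mulrCA mulfK ?mulf_neq0 //.
rewrite big_distrr; apply: eq_bigr => l _ /=; rewrite big_distrr; apply: eq_bigr => m _.
by rewrite /= mulrCA mulrA.
Qed.
End Contraction.

(** * Symmetry of second derivatives *)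

Section Schwarz.
Variables (R : realType) (V : normedModType R).
Implicit Types (f : V -> R) (p u v w : V).

Lemma is_derive_line f p v (t : R) : differentiable f (p + t *: v) ->
  is_derive t 1 (fun s : R => f (p + s *: v)) ('D_v f (p + t *: v)).
Proof.
move=> df; have e : (fun h : R => h^-1 *: (f (p + (h *: 1 + t) *: v) - f (p + t *: v)))
   = (fun h : R => h^-1 *: (f (h *: v + (p + t *: v)) - f (p + t *: v))).
  apply/funext => h; congr (_ *: (f _ - _)).
  by rewrite [h *: 1]mulr1 scalerDl addrCA.
have := diff_derivable (v := v) df.
by rewrite /derivable => dv; apply: DeriveDef; rewrite /derivable /derive e.
Qed.

(** By the mean value theorem the second difference is [h] times a difference of
    values of ['D_u f] at two points [h *: w] apart, and ['D_u f] is affine up to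
    a small error near [p]. *)
Lemma second_difference f p u w (e : R) :
  (\forall x \near p, differentiable f x) -> differentiable ('D_u f) p -> 0 < e ->
  \forall h \near (0 : R)^'+,
    `|f (p + h *: u + h *: w) - f (p + h *: u) - f (p + h *: w) + f p
      - h ^+ 2 * 'D_w ('D_u f) p| <= e * h ^+ 2.
Proof.
move=> /nbhs_ballP [r r0 fr] da e0; set a := 'D_u f.
pose K := `|u| + `|w|.
have K0 : 0 <= K by rewrite addr_ge0.
(* The two points lie within [h * K] of [p], which costs [2 * K * eps]. *)
pose eps := e / (2 * K + 1).
have eps0 : 0 < eps by rewrite divr_gt0 // ltr_wpDl // mulr_ge0.
have epsE : eps * (2 * K + 1) = e.
  by rewrite divfK // gt_eqF // ltr_wpDl // mulr_ge0.
have /diff_locallyP [_ /eqaddoP /(_ _ eps0) /nbhs_ballP [d d0 ad]] := da.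
have adP z : `|z| < d -> `|a (p + z) - a p - 'D_z a p| <= eps * `|z|.
  move=> zd; have /= := ad z; rewrite -ball_normE /= sub0r normrN => /(_ zd).
  rewrite -[X in `|X| <= _ -> _]/(a (z + p) - (a p + 'd a p z)).
  by rewrite deriveE // opprD addrA [z + p]addrC.
pose m := Num.min r d.
have m0 : 0 < m by rewrite lt_min r0 d0.
near=> h.
have h0 : 0 < h by near: h; exact: nbhs_right_gt.
have hm : h * (K + 1) < m.
  rewrite -ltr_pdivlMr ?ltr_wpDl //; near: h; apply: nbhs_right_lt.
  by rewrite divr_gt0 // ltr_wpDl.
have zK (t s : R) : 0 <= t <= 1 -> 0 <= s <= 1 ->
    `|t *: (h *: u) + s *: (h *: w)| <= h * K.
  have hz (x : R) z : 0 <= x <= 1 -> `|x *: (h *: z)| <= h * `|z|.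
    move=> /andP [x0 x1]; rewrite !normrZ (ger0_norm x0) (gtr0_norm h0).
    by rewrite ler_piMl // mulr_ge0 // ltW.
  move=> ht hs; rewrite (le_trans (ler_normD _ _)) //.
  by rewrite mulrDr lerD // hz.
have zm (t s : R) : 0 <= t <= 1 -> 0 <= s <= 1 ->
    `|t *: (h *: u) + s *: (h *: w)| < m.
  move=> ht hs; apply: le_lt_trans (zK t s ht hs) _; apply: le_lt_trans hm.
  by rewrite ler_pM2l // lerDl.
have fd (t s : R) : 0 <= t <= 1 -> 0 <= s <= 1 ->
    differentiable f (p + s *: (h *: w) + t *: (h *: u)).
  move=> ht hs; apply: fr; rewrite -ball_normE /= -addrA opprD addrA subrr sub0r.
  by rewrite normrN addrC; apply: lt_le_trans (zm t s ht hs) _; rewrite ge_min lexx.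
pose g (t : R) := f (p + h *: w + t *: (h *: u)) - f (p + t *: (h *: u)).
have Dg (t : R) : 0 <= t <= 1 ->
   is_derive t 1 g (h * (a (p + h *: w + t *: (h *: u)) - a (p + t *: (h *: u)))).
  move=> ht.
  have d1 := fd t 1 ht; rewrite scale1r ler01 lexx in d1; have {}d1 := d1 isT.
  have d2 := fd t 0 ht; rewrite scale0r addr0 ler01 lexx in d2; have {}d2 := d2 isT.
  have D1 := is_derive_line d1; have D2 := is_derive_line d2.
  apply: is_derive_eq (is_deriveB D1 D2) _.
  by rewrite /a !deriveE // !linearZ /= -scalerDr.
have [c c01 gc] : exists2 c, c \in `]0, 1[%R & g 1 - g 0 =
    h * (a (p + h *: w + c *: (h *: u)) - a (p + c *: (h *: u))) * (1 - 0).
  apply: (@MVT _ g _ 0 1) => //.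
    move=> x; rewrite in_itv /= => /andP [x0 x1]; apply: Dg.
    by rewrite !ltW.
  apply: derivable_within_continuous => x; rewrite in_itv /= => hx.
  by have [] := Dg x hx.
have hc : 0 <= c <= 1.
  by move: c01; rewrite in_itv /= => /andP [? ?]; rewrite !ltW.
have -> : f (p + h *: u + h *: w) - f (p + h *: u) - f (p + h *: w) + f p = g 1 - g 0.
  rewrite /g !scale1r !scale0r !addr0 [p + h *: w + _]addrAC.
  by move: (f _) (f _) (f _) (f _) => x1 x2 x3 x4; ring.
rewrite gc subr0 mulr1.
have z1 := zK c 1 hc; rewrite ler01 lexx scale1r in z1; have {}z1 := z1 isT.
have z2 := zK c 0 hc; rewrite ler01 lexx scale0r addr0 in z2; have {}z2 := z2 isT.
have m1 := zm c 1 hc; rewrite ler01 lexx scale1r in m1; have {}m1 := m1 isT.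
have m2 := zm c 0 hc; rewrite ler01 lexx scale0r addr0 in m2; have {}m2 := m2 isT.
have md : m <= d by rewrite ge_min lexx orbT.
have a1 := adP _ (lt_le_trans m1 md); have a2 := adP _ (lt_le_trans m2 md).
have -> : p + h *: w + c *: (h *: u) = p + (c *: (h *: u) + h *: w).
  by rewrite -addrA [h *: w + _]addrC.
set A1 := a (p + (_ + _)) in a1 *; set A2 := a (p + _) in a2 *.
rewrite expr2 -mulrA -mulrBr.
have -> : A1 - A2 - h * 'D_w a p =
   (A1 - a p - 'D_(c *: (h *: u) + h *: w) a p) - (A2 - a p - 'D_(c *: (h *: u)) a p).
  have -> : 'D_(c *: (h *: u) + h *: w) a p = 'D_(c *: (h *: u)) a p + h * 'D_w a p.
    by rewrite !deriveE // linearD [X in _ + X]linearZ.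
  clear a1 a2; move: A1 A2 (a p) ('D_(_) a p) ('D_w a p) => x1 x2 x3 x4 x5 *; ring.
rewrite normrM gtr0_norm //.
rewrite [leRHS]mulrCA ler_pM2l //.
apply: le_trans (ler_normB _ _) _.
apply: le_trans (lerD a1 a2) _; rewrite -mulrDr.
apply: le_trans (_ : eps * (h * (2 * K + 1)) <= _).
  rewrite ler_pM2l //; apply: le_trans (lerD z1 z2) _.
  by rewrite -mulrDr ler_pM2l // mulr2n mulrDl mul1r lerDl.
by rewrite mulrCA epsE mulrC.
Unshelve. all: by end_near. Qed.

(** The second difference is symmetric in [u] and [w]. *)
Lemma schwarz f p u w : (\forall x \near p, differentiable f x) ->
  differentiable ('D_u f) p -> differentiable ('D_w f) p ->
  'D_u ('D_w f) p = 'D_w ('D_u f) p.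
Proof.
move=> fd du dw; apply/eqP; rewrite -subr_eq0 -normr_le0.
apply/ler_addgt0Pl => e e0; rewrite addr0.
have e2 : 0 < e / 2 by rewrite divr_gt0.
have H1 := @second_difference f p u w _ fd du e2.
have H2 := @second_difference f p w u _ fd dw e2.
have [h [h0 [b1 b2]]] := filter_ex (filterI (nbhs_right_gt (0 : R)) (filterI H1 H2)).
have h2 : 0 < h ^+ 2 by rewrite exprn_gt0.
rewrite -(ler_pM2r h2) -{1}(gtr0_norm h2) -normrM mulrBl.
rewrite [p + h *: w + h *: u]addrAC in b2.
set X := f (p + _ + _) in b1 b2; set Y := f (p + h *: u) in b1 b2.
set Z := f (p + h *: w) in b1 b2.
set k := h ^+ 2 in b1 b2 h2 *; move: ('D_w ('D_u f) p) ('D_u ('D_w f) p) (f p) b1 b2.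
move: X Y Z k {h2} => x y z k a b c b1 b2.
have -> : b * k - a * k = (x - y - z + c - k * a) - (x - z - y + c - k * b) by ring.
apply: le_trans (ler_normB _ _) _; apply: le_trans (lerD b1 b2) _.
by rewrite -mulrDl -splitr.
Qed.
End Schwarz.

(** * Calculus of complex-valued functions *)

Section ComplexCalculus.
Variables (R : realType) (n : nat).
Local Notation C := R[i].
Local Notation V := (model R n).
Implicit Types (f g : V -> C) (p u w : V).

(** Real differentiability of a complex-valued function. *)
Definition cdiff f p : Prop :=
  differentiable (fun q => complex.Re (f q)) p /\
  differentiable (fun q => complex.Im (f q)) p.

Lemma ReD (x y : C) : complex.Re (x + y) = complex.Re x + complex.Re y.
Proof. by case: x; case: y. Qed.
Lemma ImD (x y : C) : complex.Im (x + y) = complex.Im x + complex.Im y.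
Proof. by case: x; case: y. Qed.
Lemma ReM (x y : C) : complex.Re (x * y) =
  complex.Re x * complex.Re y - complex.Im x * complex.Im y.
Proof. by case: x; case: y. Qed.
Lemma ImM (x y : C) : complex.Im (x * y) =
  complex.Re x * complex.Im y + complex.Im x * complex.Re y.
Proof. by case: x; case: y. Qed.

Lemma complex_eq (x y : C) : complex.Re x = complex.Re y ->
  complex.Im x = complex.Im y -> x = y.
Proof. by case: x => a b; case: y => c d /= -> ->. Qed.

Lemma cdiff_cst (c : C) p : cdiff (fun=> c) p.
Proof. by split; exact: differentiable_cst. Qed.

Lemma cdiffD f g p : cdiff f p -> cdiff g p -> cdiff (fun q => f q + g q) p.
Proof.
move=> [f1 f2] [g1 g2]; split.
  by under eq_fun do rewrite ReD; exact: differentiableD.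
by under eq_fun do rewrite ImD; exact: differentiableD.
Qed.

Lemma cdiffM f g p : cdiff f p -> cdiff g p -> cdiff (fun q => f q * g q) p.
Proof.
move=> [f1 f2] [g1 g2]; split.
  under eq_fun do rewrite ReM.
  by apply: differentiableB; apply: differentiableM.
under eq_fun do rewrite ImM.
by apply: differentiableD; apply: differentiableM.
Qed.

Lemma cdiffZ (c : C) f p : cdiff f p -> cdiff (fun q => c * f q) p.
Proof. by move=> df; apply: cdiffM => //; exact: cdiff_cst. Qed.

Lemma cdiffN f p : cdiff f p -> cdiff (fun q => - f q) p.
Proof.
by move=> df; under eq_fun do rewrite -mulN1r; exact: cdiffZ.
Qed.

Lemma cdiff_sum (I : Type) (r : seq I) (P : pred I) (F : I -> V -> C) p :
  (forall k, P k -> cdiff (F k) p) -> cdiff (fun q => \sum_(k <- r | P k) F k q) p.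
Proof.
move=> dF; elim: r => [|k r IH].
  by under eq_fun do rewrite big_nil; exact: cdiff_cst.
have [Pk|/negbTE nPk] := boolP (P k); last by under eq_fun do rewrite big_cons nPk.
by under eq_fun do rewrite big_cons Pk; apply: cdiffD => //; exact: dF.
Qed.

Lemma cdiff_prod (I : Type) (r : seq I) (P : pred I) (F : I -> V -> C) p :
  (forall k, P k -> cdiff (F k) p) -> cdiff (fun q => \prod_(k <- r | P k) F k q) p.
Proof.
move=> dF; elim: r => [|k r IH].
  by under eq_fun do rewrite big_nil; exact: cdiff_cst.
have [Pk|/negbTE nPk] := boolP (P k); last by under eq_fun do rewrite big_cons nPk.
by under eq_fun do rewrite big_cons Pk; apply: cdiffM => //; exact: dF.
Qed.

Lemma cdiffV f p : cdiff f p -> f p != 0 -> cdiff (fun q => (f q)^-1) p.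
Proof.
move=> [f1 f2] f0.
have n0 : complex.Re (f p) ^+ 2 + complex.Im (f p) ^+ 2 != 0.
  apply: contra f0; rewrite paddr_eq0 ?sqr_ge0 // !sqrf_eq0 => /andP [/eqP a /eqP b].
  by apply/eqP/complex_eq.
have dn : differentiable
   (fun q => (complex.Re (f q) ^+ 2 + complex.Im (f q) ^+ 2)^-1) p.
  apply: differentiableV => //.
  by apply: differentiableD; apply: differentiableM.
have Re_inv (x : C) : complex.Re x^-1 =
    complex.Re x * (complex.Re x ^+ 2 + complex.Im x ^+ 2)^-1 by case: x.
have Im_inv (x : C) : complex.Im x^-1 =
    - complex.Im x * (complex.Re x ^+ 2 + complex.Im x ^+ 2)^-1.
  by case: x => a b; rewrite mulNr.
split.
  by under eq_fun do rewrite Re_inv; exact: differentiableM.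
under eq_fun do rewrite Im_inv.
by apply: differentiableM => //; exact: differentiableN.
Qed.

Lemma cdiff_real (f : V -> R) p : differentiable f p -> cdiff (fun q => (f q)%:C) p.
Proof. by move=> df; split=> //; exact: differentiable_cst. Qed.

(** First order operators at [p] that obey the rules of calculus; both the
    directional derivatives and the Wirtinger operators are of this kind. *)
Record derivation_at p (d : (V -> C) -> C) : Prop := DerivationAt {
  der_cst : forall c, d (fun=> c) = 0;
  derD : forall f g, cdiff f p -> cdiff g p -> d (fun q => f q + g q) = d f + d g;
  derM : forall f g, cdiff f p -> cdiff g p ->
    d (fun q => f q * g q) = d f * g p + f p * d g;
  der_near : forall f g, (\forall q \near p, f q = g q) -> d f = d g;
  der_chain1 : forall (h : R -> R) (y : V -> R),
    differentiable y p -> differentiable h (y p) ->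
    d (fun q => (h (y q))%:C) = (h^`()%classic (y p))%:C * d (fun q => (y q)%:C);
  der_chain : forall m (h : 'rV[R]_m -> R) (y : V -> 'rV[R]_m),
    differentiable y p -> differentiable h (y p) ->
    d (fun q => (h (y q))%:C) =
    \sum_a ('D_(delta_mx 0 a) h (y p))%:C * d (fun q => (y q 0 a)%:C)
}.

Lemma derivation_lin p d1 d2 (a b : C) : derivation_at p d1 -> derivation_at p d2 ->
  derivation_at p (fun f => a * d1 f + b * d2 f).
Proof.
move=> D1 D2; split.
- by move=> c; rewrite (der_cst D1) (der_cst D2) !mulr0 addr0.
- by move=> f g df dg; rewrite (derD D1) // (derD D2) //; ring.
- by move=> f g df dg; rewrite (derM D1) // (derM D2) //; ring.
- by move=> f g fg; rewrite (der_near D1 fg) (der_near D2 fg).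
- by move=> h y dy dh; rewrite (der_chain1 D1) // (der_chain1 D2) //; ring.
- move=> m h y dy dh; rewrite (der_chain D1) // (der_chain D2) // !big_distrr -big_split /=.
  by apply: eq_bigr => c _; ring.
Qed.

Lemma cDreal u (f : V -> R) p : cD u (fun q => (f q)%:C) p = ('D_u f p)%:C.
Proof. by rewrite /cD /= derive_cst. Qed.

Lemma derivation_cD u p : derivation_at p (fun f => cD u f p).
Proof.
split.
- by move=> c; rewrite /cD !derive_cst.
- move=> f g [f1 f2] [g1 g2]; apply: complex_eq; rewrite /cD /= -?deriveD //;
    try exact: diff_derivable.
    by congr ('D_u _ p); apply/funext => q /=; rewrite ReD.
  by congr ('D_u _ p); apply/funext => q /=; rewrite ImD.
- move=> f g [f1 f2] [g1 g2].
  pose fr q := complex.Re (f q); pose fi q := complex.Im (f q).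
  pose gr q := complex.Re (g q); pose gi q := complex.Im (g q).
  have := @diff_derivable _ _ _ _ _ u f1; have := @diff_derivable _ _ _ _ _ u f2.
  have := @diff_derivable _ _ _ _ _ u g1; have := @diff_derivable _ _ _ _ _ u g2.
  move=> e2 e1 c2 c1; apply: complex_eq; rewrite ?(ReD, ImD, ReM, ImM) /cD /=.
    have -> : (fun q => complex.Re (f q * g q)) = fr * gr - fi * gi.
      by apply/funext => q; exact: ReM.
    rewrite (deriveB (derivableM c1 e1) (derivableM c2 e2)).
    rewrite (deriveM c1 e1) (deriveM c2 e2) /fr /fi /gr /gi /GRing.scale /=.
    move: ('D_u _ p) ('D_u _ p) ('D_u _ p) ('D_u _ p) => x1 x2 x3 x4.
    by case: (f p) (g p) => x5 x6 [x7 x8] /=; ring.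
  have -> : (fun q => complex.Im (f q * g q)) = fr * gi + fi * gr.
    by apply/funext => q; exact: ImM.
  rewrite (deriveD (derivableM c1 e2) (derivableM c2 e1)).
  rewrite (deriveM c1 e2) (deriveM c2 e1) /fr /fi /gr /gi /GRing.scale /=.
  move: ('D_u _ p) ('D_u _ p) ('D_u _ p) ('D_u _ p) => x1 x2 x3 x4.
  by case: (f p) (g p) => x5 x6 [x7 x8] /=; ring.
- move=> f g fg; rewrite /cD; congr (_ +i* _); apply: near_eq_derive;
    by apply: filterS fg => q ->.
- move=> h y dy dh; rewrite !cDreal -rmorphM; congr (_%:C).
  rewrite deriveE; last exact: differentiable_comp.
  rewrite (diff_comp dy dh) /= deriveE // derive1E deriveE //.
  rewrite -[X in 'd h _ X]mulr1 [LHS](linearZ) /= mulrC.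
  by [].
- move=> m h y dy dh.
  under eq_bigr do rewrite !cDreal -rmorphM.
  rewrite cDreal -rmorph_sum; congr (_%:C).
  rewrite deriveE; last exact: differentiable_comp.
  rewrite (diff_comp dy dh) /= -(deriveE u dy) derive_mx; last exact: diff_derivable.
  rewrite [X in 'd h _ X]row_sum_delta linear_sum; apply: eq_bigr => a _.
  by rewrite linearZ /= mxE -deriveE // mulrC.
Qed.

Lemma derivation_dz j p : derivation_at p (fun f => dz j f p).
Proof.
have D := derivation_lin (2^-1) (- (2^-1 * 'i)) (derivation_cD (ddx R j) p)
  (derivation_cD (ddy R j) p).
rewrite (_ : (fun f => dz j f p) = (fun f : V -> C =>
   2^-1 * cD (ddx R j) f p + - (2^-1 * 'i) * cD (ddy R j) f p)) //.
apply/funext => f; rewrite /dz; move: (cD _ _ _) (cD _ _ _) => x y.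
by rewrite mulrDr mulrN mulNr mulrA.
Qed.

Lemma derivation_dzb j p : derivation_at p (fun f => dzb j f p).
Proof.
have D := derivation_lin (2^-1) (2^-1 * 'i) (derivation_cD (ddx R j) p)
  (derivation_cD (ddy R j) p).
rewrite (_ : (fun f => dzb j f p) = (fun f : V -> C =>
   2^-1 * cD (ddx R j) f p + (2^-1 * 'i) * cD (ddy R j) f p)) //.
apply/funext => f; rewrite /dzb; move: (cD _ _ _) (cD _ _ _) => x y.
by rewrite mulrDr mulrA.
Qed.
End ComplexCalculus.

Lemma differentiable_near (R : realType) (V W : normedModType R) (f g : V -> W) p :
  (\forall q \near p, f q = g q) -> differentiable f p -> differentiable g p.
Proof.
move=> fg df; have e : f p = g p by exact: nbhs_singleton fg.
have /diff_locallyP [cf lf] := df.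
have lg : g \o shift p = cst (g p) + 'd f p +o_ 0 id.
  apply/eqaddoP => eps eps0; have /eqaddoP/(_ _ eps0) := lf; rewrite e.
  have fg0 : \forall z \near (0 : V), f (z + p) = g (z + p).
    move: fg; rewrite (near_shift 0 p) => h0; apply: filterS h0 => z /=.
    by rewrite subr0.
  by apply: filterS2 fg0 => z; rewrite !fctE /= => ->.
apply/diff_locallyP; have dE := diff_unique cf lg.
split; first by move=> x; rewrite dE; exact: cf.
by rewrite dE.
Qed.

Lemma cdiff_near (R : realType) n (f g : model R n -> R[i]) p :
  (\forall q \near p, f q = g q) -> cdiff f p -> cdiff g p.
Proof.
move=> fg [f1 f2]; split; [apply: differentiable_near f1|apply: differentiable_near f2];
  by apply: filterS fg => q ->.
Qed.

Section MatrixCalculus.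
Variables (R : realType) (n : nat).
Local Notation C := R[i].
Local Notation V := (model R n).
Variables (p : V) (d : (V -> C) -> C).
Hypothesis D : derivation_at p d.

Lemma derZ (c : C) f : cdiff f p -> d (fun q => c * f q) = c * d f.
Proof.
by move=> df; rewrite (derM D) ?(der_cst D) ?mul0r ?add0r //; exact: cdiff_cst.
Qed.

Lemma derN f : cdiff f p -> d (fun q => - f q) = - d f.
Proof.
move=> df; rewrite -mulN1r -derZ //; congr d; apply/funext => q.
by rewrite mulN1r.
Qed.

Lemma der_sum (I : Type) (r : seq I) (F : I -> V -> C) :
  (forall k, cdiff (F k) p) -> d (fun q => \sum_(k <- r) F k q) = \sum_(k <- r) d (F k).
Proof.
move=> dF; elim: r => [|k r IH].
  by under eq_fun do rewrite big_nil; rewrite big_nil (der_cst D).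
rewrite big_cons -IH -(derD D) //; last exact: cdiff_sum.
by congr d; apply/funext => q; rewrite big_cons.
Qed.

Lemma der_prod_seq (I : eqType) (r : seq I) (F : I -> V -> C) : uniq r ->
  (forall k, cdiff (F k) p) ->
  d (fun q => \prod_(k <- r) F k q) =
  \sum_(k <- r) d (F k) * \prod_(j <- r | j != k) F j p.
Proof.
move=> + dF; elim: r => [|k r IH] /= => [_|/andP [kr ur]].
  by under eq_fun do rewrite big_nil; rewrite big_nil (der_cst D).
under eq_fun do rewrite big_cons.
rewrite (derM D) //; last exact: cdiff_prod.
rewrite IH // big_cons big_cons eqxx /=; congr (_ * _ + _).
  rewrite [RHS]big_seq_cond [LHS]big_seq; apply: eq_bigl => j.
  by case: (boolP (j \in r)) => //= jr; apply/esym; apply: contraNneq kr => <-.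
rewrite big_distrr big_seq [RHS]big_seq /=; apply: eq_bigr => j jr.
have kj : k != j by apply: contraNneq kr => ->.
by rewrite big_cons kj mulrCA.
Qed.

Lemma der_prod (I : finType) (F : I -> V -> C) : (forall k, cdiff (F k) p) ->
  d (fun q => \prod_k F k q) = \sum_k d (F k) * \prod_(j | j != k) F j p.
Proof. by move=> dF; apply: der_prod_seq => //; exact: index_enum_uniq. Qed.

Section Matrices.
Variable m : nat.
Implicit Types M N : V -> 'M[C]_m.

Definition cdiff_mx M : Prop := forall i j, cdiff (fun q => M q i j) p.
Definition der_mx M : 'M[C]_m := \matrix_(i, j) d (fun q => M q i j).

Lemma der_mxE M j k : der_mx M j k = d (fun q => M q j k).
Proof. exact: mxE. Qed.

Lemma cdiff_mulmx M N : cdiff_mx M -> cdiff_mx N -> cdiff_mx (fun q => M q *m N q).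
Proof.
move=> dM dN i j; under eq_fun do rewrite mxE.
by apply: cdiff_sum => k _; apply: cdiffM.
Qed.

Lemma der_mulmx M N : cdiff_mx M -> cdiff_mx N ->
  der_mx (fun q => M q *m N q) = der_mx M *m N p + M p *m der_mx N.
Proof.
move=> dM dN; apply/matrixP => i j; rewrite !mxE.
under eq_fun do rewrite mxE.
rewrite der_sum => [|k]; last exact: cdiffM.
rewrite -big_split /=; apply: eq_bigr => k _.
by rewrite (derM D) // !mxE.
Qed.

(** Differentiate [M *m N = 1%:M]. *)
Lemma der_mx_inv M N : cdiff_mx M -> cdiff_mx N ->
  (\forall q \near p, M q *m N q = 1%:M) -> der_mx N = - (N p *m der_mx M *m N p).
Proof.
move=> dM dN MN; have MNp : M p *m N p = 1%:M by exact: nbhs_singleton MN.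
have e : der_mx (fun q => M q *m N q) = 0.
  apply/matrixP => i j; rewrite !mxE -[RHS](der_cst D (1%:M i j)).
  by apply: (der_near D); apply: filterS MN => q ->.
move: e; rewrite der_mulmx // => /eqP; rewrite addrC addr_eq0 => /eqP e.
by rewrite -[LHS]mul1mx -(mulmx1C MNp) -!mulmxA e mulmxN.
Qed.

Lemma cdiff_det M : cdiff_mx M -> cdiff (fun q => \det (M q)) p.
Proof.
move=> dM; apply: cdiff_sum => s _; apply: cdiffZ.
by apply: cdiff_prod.
Qed.

(** Jacobi's formula: the derivative of the Leibniz sum regroups into a cofactor
    expansion along each row. *)
Lemma der_det M : cdiff_mx M ->
  d (fun q => \det (M q)) = \tr (der_mx M *m \adj (M p)).
Proof.
move=> dM; rewrite /determinant der_sum; last first.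
  by move=> s; apply: cdiffZ; apply: cdiff_prod.
transitivity (\sum_(s : 'S_m) \sum_i (-1) ^+ s *
    (d (fun q => M q i (s i)) * \prod_(j | i != j) M p j (s j))).
  apply: eq_bigr => s _; rewrite derZ; last exact: cdiff_prod.
  rewrite der_prod // big_distrr /=; apply: eq_bigr => i _.
  by congr (_ * (_ * _)); apply: eq_bigl => j; rewrite eq_sym.
rewrite exchange_big; apply: eq_bigr => i _ /=.
rewrite (partition_big (fun s : 'S_m => s i) predT) //= mxE; apply: eq_bigr => j _.
rewrite !mxE expand_cofactor big_distrr /=; apply: eq_bigr => s /eqP <-.
by rewrite mulrCA.
Qed.
End Matrices.
End MatrixCalculus.

Lemma cdiff_adj (R : realType) n (p : model R n) m (M : model R n -> 'M[R[i]]_m) :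
  cdiff_mx p M -> cdiff_mx p (fun q => \adj (M q)).
Proof.
move=> dM i j; under eq_fun do rewrite mxE /cofactor.
apply: cdiffZ; apply: cdiff_det => k l.
by under eq_fun do rewrite !mxE.
Qed.

(** * Wirtinger operators *)

Section Wirtinger.
Variables (R : realType) (n : nat).
Local Notation C := R[i].
Local Notation V := (model R n).
Implicit Types (f : V -> C) (p u w : V).

Lemma model_decomp u : u = \sum_j (u.1 0 j *: ddx R j + u.2 0 j *: ddy R j).
Proof.
have fstE : forall r : seq 'I_n, (\sum_(j <- r) (u.1 0 j *: ddx R j + u.2 0 j *: ddy R j)) =
   (\sum_(j <- r) u.1 0 j *: delta_mx 0 j, \sum_(j <- r) u.2 0 j *: delta_mx 0 j) :> V.
  elim=> [|j r IH]; first by rewrite !big_nil.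
  rewrite !big_cons IH; congr (_, _) => /=.
    by rewrite scaler0 addr0.
  by rewrite scaler0 add0r.
by rewrite fstE -!row_sum_delta -surjective_pairing.
Qed.

Lemma cD_frame u f p : cdiff f p ->
  cD u f p = \sum_j ((u.1 0 j)%:C * cD (ddx R j) f p + (u.2 0 j)%:C * cD (ddy R j) f p).
Proof.
have DE (g : V -> R) : differentiable g p -> 'D_u g p =
    \sum_j (u.1 0 j * 'D_(ddx R j) g p + u.2 0 j * 'D_(ddy R j) g p).
  move=> dg; rewrite deriveE // {1}[u]model_decomp linear_sum; apply: eq_bigr => j _.
  by rewrite linearD !linearZ -!deriveE.
have Re_realM (a : R) (z : C) : complex.Re (a%:C * z) = a * complex.Re z.
  by rewrite ReM mul0r subr0.
have Im_realM (a : R) (z : C) : complex.Im (a%:C * z) = a * complex.Im z.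
  by rewrite ImM mul0r addr0.
have Re_sum (F : 'I_n -> C) : complex.Re (\sum_j F j) = \sum_j complex.Re (F j).
  by apply: (big_ind2 (fun (x : C) (y : R) => complex.Re x = y)) => // x1 x2 y1 y2 <- <-; exact: ReD.
have Im_sum (F : 'I_n -> C) : complex.Im (\sum_j F j) = \sum_j complex.Im (F j).
  by apply: (big_ind2 (fun (x : C) (y : R) => complex.Im x = y)) => // x1 x2 y1 y2 <- <-; exact: ImD.
move=> [f1 f2]; apply: complex_eq; rewrite /cD /= ?Re_sum ?Im_sum DE //.
  by apply: eq_bigr => j _; rewrite ReD !Re_realM.
by apply: eq_bigr => j _; rewrite ImD !Im_realM.
Qed.

Lemma cD_wirtinger u f p : cdiff f p ->
  cD u f p = \sum_j (toC u 0 j * dz j f p + conjc (toC u 0 j) * dzb j f p).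
Proof.
move=> df; rewrite cD_frame //; apply: eq_bigr => j _.
have -> : toC u 0 j = (u.1 0 j)%:C + 'i * (u.2 0 j)%:C.
  by rewrite mxE [LHS]complexE.
rewrite conjcD conjcM !conjcR conjci /dz /dzb.
move: (_%:C) (_%:C) (cD _ f p) (cD _ f p) => a b X Y.
transitivity (b * Y - 'i * 'i * (a * X)); first by rewrite mulii mulN1r opprK.
by move: 'i => k; field.
Qed.

Lemma cD_conj u f p : cdiff f p -> cD u (fun q => conjc (f q)) p = conjc (cD u f p).
Proof.
have Re_conj (x : C) : complex.Re (conjc x) = complex.Re x by case: x.
have Im_conj (x : C) : complex.Im (conjc x) = - complex.Im x by case: x.
move=> [f1 f2]; apply: complex_eq; rewrite /cD /=.
  by under eq_fun do rewrite Re_conj.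
under eq_fun do rewrite Im_conj.
by rewrite deriveN //; exact: diff_derivable.
Qed.

Lemma dzb_conj j f p : cdiff f p -> dzb j (fun q => conjc (f q)) p = conjc (dz j f p).
Proof.
move=> df; by rewrite /dzb /dz !cD_conj // conjcM conjcB conjcM conjci conjc_half mulNr opprK.
Qed.

Definition cdiff2 (U : set V) f : Prop :=
  forall p, U p -> cdiff f p /\ forall u, cdiff (cD u f) p.

Section Twice.
Variables (U : set V) (f : V -> C) (p : V).
Hypotheses (openU : open U) (Up : U p) (df : cdiff2 U f).

Lemma cD_comm u w : cD u (cD w f) p = cD w (cD u f) p.
Proof.
have near_df : \forall q \near p, cdiff f q.
  by near=> q; apply: (df _).1; near: q; exact: open_nbhs_nbhs.
have [_ d2] := df Up; have [u1 u2] := d2 u; have [w1 w2] := d2 w.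
apply: complex_eq; rewrite /cD /=; apply: schwarz => //.
  by apply: filterS near_df => q [].
by apply: filterS near_df => q [].
Unshelve. all: by end_near. Qed.

Lemma cdiff_dz j : cdiff (dz j f) p.
Proof.
have [_ d2] := df Up; apply: cdiffZ; apply: cdiffD => //.
by apply: cdiffN; apply: cdiffZ.
Qed.

Lemma cdiff_dzb j : cdiff (dzb j f) p.
Proof.
by have [_ d2] := df Up; apply: cdiffZ; apply: cdiffD => //; apply: cdiffZ.
Qed.

Lemma cD_dz u j : cD u (dz j f) p = 2^-1 * (cD u (cD (ddx R j) f) p - 'i * cD u (cD (ddy R j) f) p).
Proof.
have [_ d2] := df Up; have D := derivation_cD u p.
rewrite (derZ D) ?(derD D) ?(derN D) ?(derZ D) //; try by apply: cdiffN; apply: cdiffZ.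
  exact: cdiffZ.
by apply: cdiffD => //; apply: cdiffN; apply: cdiffZ.
Qed.

Lemma cD_dzb u j : cD u (dzb j f) p = 2^-1 * (cD u (cD (ddx R j) f) p + 'i * cD u (cD (ddy R j) f) p).
Proof.
have [_ d2] := df Up; have D := derivation_cD u p.
rewrite (derZ D) ?(derD D) ?(derZ D) //; try exact: cdiffZ.
by apply: cdiffD => //; apply: cdiffZ.
Qed.

Lemma dz_comm j k : dz j (dz k f) p = dz k (dz j f) p.
Proof.
have mixed (a b c d a' b' c' d' : C) : a = a' -> b = c' -> c = b' -> d = d' ->
    2^-1 * (2^-1 * (a - 'i * b) - 'i * (2^-1 * (c - 'i * d))) =
    2^-1 * (2^-1 * (a' - 'i * b') - 'i * (2^-1 * (c' - 'i * d'))).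
  by move=> -> -> -> ->; move: 'i (2^-1) => *; ring.
by rewrite [LHS]/dz [RHS]/dz !cD_dz; apply: mixed; exact: cD_comm.
Qed.

Lemma dz_dzb_comm j k : dz j (dzb k f) p = dzb k (dz j f) p.
Proof.
have mixed (a b c d a' b' c' d' : C) : a = a' -> b = c' -> c = b' -> d = d' ->
    2^-1 * (2^-1 * (a + 'i * b) - 'i * (2^-1 * (c + 'i * d))) =
    2^-1 * (2^-1 * (a' - 'i * b') + 'i * (2^-1 * (c' - 'i * d'))).
  by move=> -> -> -> ->; move: 'i (2^-1) => *; ring.
by rewrite [LHS]/dz [RHS]/dzb !cD_dz !cD_dzb; apply: mixed; exact: cD_comm.
Qed.
End Twice.
End Wirtinger.

(** * Kaehler metrics in a chart *)

(** In a unitary basis of eigenvectors [A] is diagonal, and each eigenvalue is a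
    value of the positive form. *)
Lemma det_posdef_gt0 (R : realType) n (A : 'M[R[i]]_n) :
  (forall j k, A k j = conjc (A j k)) ->
  (forall s : 'rV_n, s != 0 -> 0 < \sum_j \sum_k s 0 j * conjc (s 0 k) * A j k) ->
  0 < \det A.
Proof.
move=> Ah Apos.
have /orthomx_spectralP AE : A \is normalmx.
  have e : map_mx Num.conj (A^T) = A by apply/matrixP => j k; rewrite !mxE; exact/esym/Ah.
  by apply/normalmxP; rewrite e.
set P := spectralmx A in AE; set sp := spectral_diag A in AE.
have Pu : P \in unitmx by exact: spectral_unit.
have Pinv : invmx P = map_mx Num.conj P^T by exact/invmx_unitary/spectral_unitarymx.
rewrite AE !det_mulmx det_inv mulrAC mulVr ?unitmxE // mul1r det_diag.
apply: prodr_gt0 => m _.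
have -> : sp 0 m = \sum_j \sum_k (row m P) 0 j * conjc ((row m P) 0 k) * A j k.
  have : P *m A *m invmx P = diag_mx sp.
    by rewrite {1}AE !mulmxA mulmxV // mul1mx mulmxK.
  move=> /matrixP /(_ m m); rewrite Pinv mxE [in RHS]mxE eqxx mulr1n => <-.
  under eq_bigr => k _ do rewrite mxE big_distrl /=.
  rewrite exchange_big; apply: eq_bigr => j _; apply: eq_bigr => k _ /=.
  by rewrite !mxE mulrAC.
apply: Apos; apply/eqP => r0.
have := mulmxV Pu => /matrixP /(_ m m); rewrite !mxE eqxx big1 => [/eqP|k _].
  by rewrite eq_sym oner_eq0.
by have /rowP /(_ k) := r0; rewrite !mxE => ->; rewrite mul0r.
Qed.

Section KahlerChart.
Variables (R : realType) (n : nat) (X : complexManifold R n).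
Variables (om : kahlerForm X) (i : chart_index X).
Local Notation C := R[i].
Local Notation V := (model R n).
Local Notation U := (chart_img i).
Local Notation H := (gram om i).
Implicit Types (p u w x : V).

Lemma JopK u : Jop (Jop u) = - u.
Proof. by case: u. Qed.

Lemma Jop_ddx j : Jop (ddx R j) = ddy R j :> V.
Proof. by rewrite /Jop /ddx /ddy /= oppr0. Qed.

Section Pointwise.
Variable p : V.
Hypothesis Up : U p.

Lemma kfDl u u' w : om i p (u + u') w = om i p u w + om i p u' w.
Proof. by have := kf_linear om 1 u u' w Up; rewrite scale1r mul1r. Qed.

Lemma kf0l w : om i p 0 w = 0.
Proof. by apply: (addrI (om i p 0 w)); rewrite -kfDl !addr0. Qed.

Lemma kfZl a u w : om i p (a *: u) w = a * om i p u w.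
Proof. by have := kf_linear om a u 0 w Up; rewrite addr0 kf0l addr0. Qed.

Lemma kfC u w : om i p u w = - om i p w u.
Proof. exact: kf_skew. Qed.

Lemma kfZr a u w : om i p u (a *: w) = a * om i p u w.
Proof. by rewrite kfC kfZl -mulrN -kfC. Qed.

Lemma kfNr u w : om i p u (- w) = - om i p u w.
Proof. by rewrite -scaleN1r kfZr mulN1r. Qed.

Lemma kf_Jl u w : om i p (Jop u) w = - om i p u (Jop w).
Proof. by rewrite -(kf_J om u (Jop w) Up) JopK kfNr opprK. Qed.

Lemma toCK u : ofC (toC u) = u.
Proof. by case: u => a b; congr (_, _); apply/rowP => j; rewrite !mxE. Qed.

Lemma ofCK (s : 'rV[C]_n) : toC (ofC s) = s.
Proof. by apply/rowP => j; rewrite !mxE; case: (s 0 j). Qed.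

Lemma ofC_linear (c : C) (s s' : 'rV[C]_n) :
  ofC (c *: s + s') = complex.Re c *: ofC s + complex.Im c *: Jop (ofC s) + ofC s'.
Proof.
congr (_, _); apply/rowP => j; rewrite !mxE.
  by rewrite ReD ReM mulrN.
by rewrite ImD ImM.
Qed.

Lemma herm_linear (c : C) (s s' t : 'rV[C]_n) :
  herm om i p (c *: s + s') t = c * herm om i p s t + herm om i p s' t.
Proof.
rewrite /herm /metric /omC ofC_linear !kfDl !kfZl !kf_Jl JopK kfNr opprK.
move: (om i p (ofC s) _) (om i p (ofC s) _) (om i p (ofC s') _) (om i p (ofC s') _).
move=> a b a' b'; rewrite [c in RHS](complexE c : c = (complex.Re c)%:C + 'i * (complex.Im c)%:C).
rewrite !(rmorphD, rmorphM, rmorphN) /=.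
move: (complex.Re c)%:C (complex.Im c)%:C a%:C b%:C a'%:C b'%:C.
move=> x1 x2 x3 x4 x5 x6.
transitivity (2^-1 * (x1 * x4 + 'i * (x2 * x4) - 'i * x1 * x3 - 'i * 'i * (x2 * x3))
   + 2^-1 * (x6 - 'i * x5)).
  by rewrite mulii; move: 'i (2^-1) => *; ring.
by move: 'i (2^-1) => *; ring.
Qed.

Lemma herm_conj s t : herm om i p t s = conjc (herm om i p s t).
Proof.
rewrite /herm /metric /omC conjcM conjc_half conjcB conjcM conjci !conjcR.
rewrite [om i p (ofC t) (ofC s)]kfC [om i p (ofC t) (Jop _)]kfC kf_Jl opprK.
by rewrite rmorphN mulrN mulNr.
Qed.

Lemma herm_row s t :
  herm om i p s t = \sum_j \sum_k s 0 j * conjc (t 0 k) * H p j k.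
Proof.
have h0 t' : herm om i p 0 t' = 0.
  by have := herm_linear (-1) 0 0 t'; rewrite scaleN1r oppr0 addr0 mulN1r addNr.
have hl s' t' : herm om i p s' t' = \sum_j s' 0 j * herm om i p (delta_mx 0 j) t'.
  rewrite {1}[s']row_sum_delta.
  elim: (index_enum _) => [|j r IH]; first by rewrite !big_nil.
  by rewrite !big_cons herm_linear IH.
rewrite hl; apply: eq_bigr => j _; rewrite herm_conj hl.
rewrite (big_morph _ (@conjcD R) (conjc0 R)) big_distrr /=; apply: eq_bigr => k _.
by rewrite conjcM -herm_conj mulrA /gram mxE.
Qed.

Lemma gram_conj j k : H p k j = conjc (H p j k).
Proof. by rewrite !mxE herm_conj. Qed.

(** omega(u, w) = i (h(u, w) - h(w, u)): the form is minus twice the imaginary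
    part of the metric. *)
Lemma kf_form11 u w : omC om i p u w = 'i * form11 (H p) u w.
Proof.
have -> : form11 (H p) u w = herm om i p (toC u) (toC w) - herm om i p (toC w) (toC u).
  rewrite !herm_row -sumrB; apply: eq_bigr => j _; rewrite -sumrB.
  by apply: eq_bigr => k _; rewrite -mulrBl mulrC.
rewrite /herm !toCK /metric /omC [om i p w (Jop u)]kfC kf_Jl opprK.
rewrite [om i p w u]kfC rmorphN /= -mulrBr.
move: (om i p u w)%:C (om i p u (Jop w))%:C => a b.
transitivity (- ('i * 'i) * a); first by rewrite mulii opprK mul1r.
by move: 'i => k; field.
Qed.

Lemma herm_gt0 s : s != 0 -> 0 < herm om i p s s.
Proof.
move=> s0; have u0 : ofC s != 0.
  apply: contra s0 => /eqP e; rewrite -[s]ofCK e.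
  by apply/eqP/rowP => j; rewrite !mxE; exact/eqP.
rewrite /herm /omC.
have -> : om i p (ofC s) (ofC s) = 0.
  have := kfC (ofC s) (ofC s); move: (om i p _ _) => y; lra.
rewrite mulr0 subr0 mulr_gt0 ?invr_gt0 ?ltr0n // ltcR.
exact: kf_positive.
Qed.

Lemma det_gram_gt0 : 0 < \det (H p).
Proof.
apply: det_posdef_gt0 => [j k|s s0]; first exact: gram_conj.
by rewrite -herm_row; exact: herm_gt0.
Qed.

Lemma gram_unit : H p \in unitmx.
Proof. by rewrite unitmxE unitfE gt_eqF // det_gram_gt0. Qed.
End Pointwise.

Lemma ofC_delta j : ofC (delta_mx 0 j : 'rV[C]_n) = ddx R j.
Proof.
by congr (_, _); apply/rowP => k; rewrite !mxE eqxx /=; case: (k == j).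
Qed.

Lemma gramE p j k : H p j k =
  2^-1 * ((om i p (ddx R j) (ddy R k))%:C - 'i * (om i p (ddx R j) (ddx R k))%:C).
Proof. by rewrite mxE /herm !ofC_delta /metric Jop_ddx. Qed.

Lemma open_chart : open U.
Proof. exact: chart_img_open. Qed.

Lemma nearU p : U p -> \forall q \near p, U q.
Proof. by move=> Up; apply: open_nbhs_nbhs; split => //; exact: open_chart. Qed.

Lemma kf_diff u w p : U p -> differentiable (fun q => om i q u w) p.
Proof. by move=> Up; have [d _] := kf_smooth om i u w 1; apply: d. Qed.

Lemma kf_diff2 u w x p : U p -> differentiable ('D_x (fun q => om i q u w)) p.
Proof. by move=> Up; have [_ d] := kf_smooth om i u w 2; have [+ _] := d x; apply. Qed.

Lemma cD_gram p u j k : U p -> cD u (fun q => H q j k) p =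
  2^-1 * (('D_u (fun q => om i q (ddx R j) (ddy R k)) p)%:C
          - 'i * ('D_u (fun q => om i q (ddx R j) (ddx R k)) p)%:C).
Proof.
move=> Up; have D := derivation_cD u p; under eq_fun do rewrite gramE.
have dS := cdiff_real (kf_diff (ddx R j) (ddy R k) Up).
have dW := cdiff_real (kf_diff (ddx R j) (ddx R k) Up).
have dW1 := cdiffZ 'i dW; have dW2 := cdiffN dW1.
by rewrite (derZ D _ (cdiffD dS dW2)) (derD D dS dW2) (derN D dW1) (derZ D _ dW) !cDreal.
Qed.

Lemma cdiff2_gram j k : cdiff2 U (fun q => H q j k).
Proof.
move=> p Up; split=> [|u].
  under eq_fun do rewrite gramE.
  apply: cdiffZ; apply: cdiffD; first exact/cdiff_real/kf_diff.
  by apply: cdiffN; apply: cdiffZ; exact/cdiff_real/kf_diff.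
apply: (@cdiff_near _ _ (fun q =>   2^-1 * (('D_u (fun q => om i q (ddx R j) (ddy R k)) q)%:C
          - 'i * ('D_u (fun q => om i q (ddx R j) (ddx R k)) q)%:C))).
  by apply: filterS (nearU Up) => q Uq; rewrite cD_gram.
apply: cdiffZ; apply: cdiffD; first exact/cdiff_real/kf_diff2.
by apply: cdiffN; apply: cdiffZ; exact/cdiff_real/kf_diff2.
Qed.

(** The Kaehler identity.  The real and imaginary parts of 4 d_l H_ac are
    derivatives of omega along frame vectors; closedness on (x_l, x_a, y_c) and
    (y_l, y_a, y_c) gives the symmetry of the former, on (y_l, y_a, x_c) and
    (x_l, x_a, x_c) that of the latter. *)
Lemma dz_gram_sym p l a c : U p -> dz l (fun q => H q a c) p = dz a (fun q => H q l c) p.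
Proof.
move=> Up.
pose Dom x u w := 'D_x (fun q => om i q u w) p.
have Dskew x u w : Dom x u w = - Dom x w u.
  rewrite /Dom -deriveN; last exact/diff_derivable/kf_diff.
  apply: near_eq_derive; apply: filterS (nearU Up) => q Uq.
  by rewrite kf_skew.
have DJ x u w : Dom x (Jop u) w = - Dom x u (Jop w).
  rewrite /Dom -deriveN; last exact/diff_derivable/kf_diff.
  apply: near_eq_derive; apply: filterS (nearU Up) => q Uq.
  by rewrite kf_Jl.
have DJJ x u w : Dom x (Jop u) (Jop w) = Dom x u w.
  by apply: near_eq_derive; apply: filterS (nearU Up) => q Uq; rewrite kf_J.
have Dyy x (a' c' : 'I_n) : Dom x (ddy R a') (ddy R c') = Dom x (ddx R a') (ddx R c').
  by rewrite -!Jop_ddx DJJ.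
have Dyx x (a' c' : 'I_n) : Dom x (ddy R a') (ddx R c') = - Dom x (ddx R a') (ddy R c').
  by rewrite -!Jop_ddx DJ.
have dom x u w : Dom x u w + Dom u w x + Dom w x u = 0 by exact: kf_closed.
have E1 := dom (ddx R l) (ddx R a) (ddy R c).
have E2 := dom (ddy R l) (ddy R a) (ddy R c).
have E3 := dom (ddy R l) (ddy R a) (ddx R c).
have E4 := dom (ddx R l) (ddx R a) (ddx R c).
rewrite (Dskew (ddx R a) (ddy R c)) in E1.
rewrite !Dyy (Dskew (ddy R a) (ddx R c)) in E2.
rewrite Dyy Dyx (Dskew (ddy R a) (ddx R c)) Dyx in E3.
rewrite (Dskew (ddx R a) (ddx R c)) in E4.
rewrite (Dskew (ddy R c)) in E1; rewrite (Dskew (ddy R c)) in E2.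
have cDH u j k : cD u (fun q => H q j k) p =
    2^-1 * ((Dom u (ddx R j) (ddy R k))%:C - 'i * (Dom u (ddx R j) (ddx R k))%:C).
  exact: cD_gram.
rewrite /dz !cDH.
move: E1 E2 E3 E4.
move: (Dom (ddx R l) (ddx R a) (ddy R c)) (Dom (ddx R l) (ddx R a) (ddx R c)).
move: (Dom (ddy R l) (ddx R a) (ddy R c)) (Dom (ddy R l) (ddx R a) (ddx R c)).
move: (Dom (ddx R a) (ddx R l) (ddy R c)) (Dom (ddx R a) (ddx R l) (ddx R c)).
move: (Dom (ddy R a) (ddx R l) (ddy R c)) (Dom (ddy R a) (ddx R l) (ddx R c)).
move: (Dom _ _ _) (Dom _ _ _) => z1 z2 x1 x2 x3 x4 x5 x6 x7 x8.
move=> E1 E2 E3 E4.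
have dzE (a1 a2 b1 b2 : R) :
   2^-1 * (2^-1 * (a1%:C - 'i * a2%:C) - 'i * (2^-1 * (b1%:C - 'i * b2%:C))) =
   2^-1 * 2^-1 * ((a1 - b2)%:C - 'i * (a2 + b1)%:C) :> C.
  rewrite rmorphB rmorphD /=; move: a1%:C a2%:C b1%:C b2%:C => y1 y2 y3 y4.
  transitivity (2^-1 * 2^-1 * ((y1 + 'i * 'i * y4) - 'i * (y2 + y3))).
    by move: 'i (2^-1) => *; ring.
  by rewrite mulii mulN1r.
rewrite !dzE; congr (_ * (_%:C - 'i * _%:C)).
  by move: E1 E2; clear; move=> *; lra.
by move: E3 E4; clear; move=> *; lra.
Qed.

Lemma cdiff_gram p j k : U p -> cdiff (fun q => H q j k) p.
Proof. by move=> Up; have [] := cdiff2_gram j k Up. Qed.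

Lemma dzb_gram_sym p k e d : U p -> dzb k (fun q => H q e d) p = dzb d (fun q => H q e k) p.
Proof.
move=> Up; have E m a b : dzb m (fun q => H q a b) p = conjc (dz m (fun q => H q b a) p).
  rewrite -dzb_conj; last exact: cdiff_gram.
  apply: (der_near (derivation_dzb m p)); apply: filterS (nearU Up) => q Uq.
  exact: gram_conj.
by rewrite !E (dz_gram_sym _ _ _ Up).
Qed.

(** Two Kaehler identities move the indices [l] and [j], then [m] and [d]; the
    operators commute in between. *)
Lemma gram_hess_sym p l m j d : U p ->
  dzb m (dz l (fun q => H q j d)) p = dz j (dzb d (fun q => H q l m)) p.
Proof.
move=> Up; transitivity (dzb m (dz j (fun q => H q l d)) p).
  apply: (der_near (derivation_dzb m p)); apply: filterS (nearU Up) => q Uq.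
  exact: dz_gram_sym.
rewrite -(dz_dzb_comm open_chart Up (cdiff2_gram l d)).
apply: (der_near (derivation_dz j p)); apply: filterS (nearU Up) => q Uq.
exact: dzb_gram_sym.
Qed.
End KahlerChart.

(** * The Chern curvature *)

(** The part of the curvature of type (2,0) cancels.  [D], [B] and [Q] stand for
    the holomorphic derivatives, the antiholomorphic derivatives and the products
    of the connection coefficients. *)
Lemma curvature_20_cancel (F : comNzRingType) (I : finType) (u w ub wb : I -> F)
    (D B Q : I -> I -> F) : (forall l m, D l m - D m l = Q m l - Q l m) ->
  \sum_l \sum_m w l * (u m * D l m + ub m * B l m) + \sum_l \sum_m w l * u m * Q l m -
  (\sum_l \sum_m u l * (w m * D l m + wb m * B l m) + \sum_l \sum_m u l * w m * Q l m) =
  \sum_l \sum_m - B l m * (u l * wb m - w l * ub m).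
Proof.
move=> comm; have sym l m : D l m + Q l m = D m l + Q m l.
  by have := comm l m; move/eqP; rewrite subr_eq addrAC -subr_eq opprK => /eqP ->; rewrite addrC.
have swap : \sum_l \sum_m w l * u m * (D l m + Q l m) =
            \sum_l \sum_m u l * w m * (D l m + Q l m).
  rewrite exchange_big; apply: eq_bigr => l _; apply: eq_bigr => m _ /=.
  by rewrite sym [w m * u l]mulrC.
apply/eqP; rewrite -subr_eq0 -[X in _ == X](subrr (\sum_l \sum_m w l * u m * (D l m + Q l m))).
rewrite {2}swap -!big_split -!sumrB /=; apply/eqP; apply: eq_bigr => l _.
rewrite -!big_split -!sumrB /=; apply: eq_bigr => m _; ring.
Qed.

Section Curvature.
Variables (R : realType) (n : nat) (X : complexManifold R n).
Variables (om : kahlerForm X) (i : chart_index X).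
Local Notation C := R[i].
Local Notation V := (model R n).
Local Notation U := (chart_img i).
Local Notation H := (gram om i).
Implicit Types (p q u w x : V).

(** The inverse Gram matrix as a rational expression, which is differentiable by
    the rules of calculus, unlike the case distinction inside [invmx]. *)
Definition gram_inv q : 'M[C]_n := (\det (H q))^-1 *: \adj (H q).
Local Notation G := gram_inv.

Definition dzH l q : 'M[C]_n := der_mx (fun f => dz l f q) H.
Definition dzbH l q : 'M[C]_n := der_mx (fun f => dzb l f q) H.

Lemma dzHE l q j k : dzH l q j k = dz l (fun x => H x j k) q.
Proof. exact: mxE. Qed.

Lemma dzbHE l q j k : dzbH l q j k = dzb l (fun x => H x j k) q.
Proof. exact: mxE. Qed.

(** The connection coefficients: [chern_form p u = sum_l u_l christoffel l]. *)
Definition christoffel l q : 'M[C]_n := dzH l q *m G q.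

Local Opaque dz dzb cD gram.

Lemma gram_invE q : U q -> invmx (H q) = G q.
Proof. by move=> Uq; rewrite /invmx gram_unit. Qed.

Lemma gram_mulV q : U q -> H q *m G q = 1%:M.
Proof. by move=> Uq; rewrite -gram_invE // mulmxV // gram_unit. Qed.

Lemma gram_mulVl q : U q -> G q *m H q = 1%:M.
Proof. by move=> Uq; rewrite -gram_invE // mulVmx // gram_unit. Qed.

Lemma cdiff_mx_gram p : U p -> cdiff_mx p H.
Proof. by move=> Up j k; exact: cdiff_gram. Qed.

Lemma cdiff_mx_gram_inv p : U p -> cdiff_mx p G.
Proof.
move=> Up j k; under eq_fun do rewrite mxE.
have dH := cdiff_mx_gram Up.
apply: cdiffM; last exact: cdiff_adj.
by apply: cdiffV; [exact: cdiff_det|rewrite gt_eqF // det_gram_gt0].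
Qed.

Lemma cdiff_mx_dzH l p : U p -> cdiff_mx p (dzH l).
Proof.
move=> Up j k; under eq_fun do rewrite mxE.
exact: cdiff_dz Up (cdiff2_gram _ _ _) _.
Qed.

Lemma cdiff_mx_dzbH l p : U p -> cdiff_mx p (dzbH l).
Proof.
move=> Up j k; under eq_fun do rewrite mxE.
exact: cdiff_dzb Up (cdiff2_gram _ _ _) _.
Qed.

Lemma cdiff_mx_christoffel l p : U p -> cdiff_mx p (christoffel l).
Proof.
by move=> Up; apply: cdiff_mulmx; [exact: cdiff_mx_dzH|exact: cdiff_mx_gram_inv].
Qed.

Lemma der_gram_inv p d : U p -> derivation_at p d ->
  der_mx d G = - (G p *m der_mx d H *m G p).
Proof.
move=> Up D; apply: (der_mx_inv D); first exact: cdiff_mx_gram.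
  exact: cdiff_mx_gram_inv.
by apply: filterS (nearU Up) => q Uq; exact: gram_mulV.
Qed.

Lemma chern_formE q u : U q ->
  chern_form om i q u = \sum_l toC u 0 l *: christoffel l q.
Proof.
move=> Uq; rewrite /chern_form gram_invE // mulmx_suml; apply: eq_bigr => l _.
by rewrite -scalemxAl.
Qed.

Lemma nabla_const u (j : 'I_n) q :
  nabla om i u (fun=> delta_mx 0 j) q = row j (chern_form om i q u).
Proof.
rewrite /nabla -rowE; apply/rowP => k; rewrite !mxE (der_cst (derivation_cD u q)).
by rewrite add0r.
Qed.

(** The (2,0)-part of the curvature of the Chern connection vanishes: with
    A_l = d_l H H^-1, the second derivatives of [H] in d_m A_l are symmetric. *)
Lemma dz_christoffel l m p : U p ->
  der_mx (fun f => dz m f p) (christoffel l) - der_mx (fun f => dz l f p) (christoffel m) =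
  christoffel m p *m christoffel l p - christoffel l p *m christoffel m p.
Proof.
move=> Up; have E a b : der_mx (fun f => dz a f p) (christoffel b) =
    der_mx (fun f => dz a f p) (dzH b) *m G p - christoffel b p *m christoffel a p.
  have D := derivation_dz a p.
  apply: eq_trans (der_mulmx D (cdiff_mx_dzH b Up) (cdiff_mx_gram_inv Up)) _.
  congr (_ + _); apply: eq_trans (congr1 (mulmx (dzH b p)) (der_gram_inv Up D)) _.
  by rewrite mulmxN /christoffel !mulmxA.
have sym : der_mx (fun f => dz m f p) (dzH l) = der_mx (fun f => dz l f p) (dzH m).
  have second a b j k : der_mx (fun f => dz a f p) (dzH b) j k =
      dz a (dz b (fun q => H q j k)) p.
    by rewrite der_mxE; congr (dz a _ p); apply/funext => q; exact: mxE.
  apply/matrixP => j k; apply: eq_trans (second m l j k) _.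
  apply: eq_trans _ (esym (second l m j k)).
  exact: (dz_comm (@open_chart _ _ _ _) Up (cdiff2_gram _ j k)).
have sub_swap (x y z a b : 'M[C]_n) : a = z - x -> b = z - y -> a - b = y - x.
  by move=> -> ->; rewrite opprB addrC addrA subrK.
have e1 := E m l; rewrite sym in e1.
exact: sub_swap e1 (E l m).
Qed.

Lemma curvature_form11 p u w j k : U p ->
  curvature om i p u w j k =
  form11 (\matrix_(l, m) (- dzb m (fun q => christoffel l q j k) p)) u w.
Proof.
move=> Up.
have cG l : cdiff (fun q => christoffel l q j k) p by exact: cdiff_mx_christoffel.
have first_term a b :
    nabla om i a (nabla om i b (fun=> delta_mx 0 j)) p 0 k =
    \sum_l \sum_m toC b 0 l * (toC a 0 m * dz m (fun q => christoffel l q j k) p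
       + conjc (toC a 0 m) * dzb m (fun q => christoffel l q j k) p)
    + \sum_l \sum_m toC b 0 l * toC a 0 m * (christoffel l p *m christoffel m p) j k.
  rewrite /nabla -/(nabla om i b (fun=> delta_mx 0 j)) mxE; congr (_ + _).
    rewrite mxE; have D := derivation_cD a p.
    transitivity (cD a (fun q => \sum_l toC b 0 l * christoffel l q j k) p).
      apply: (der_near D); apply: filterS (nearU Up) => q Uq.
      rewrite -/(nabla om i b (fun=> delta_mx 0 j) q) nabla_const mxE chern_formE //.
      by rewrite summxE; apply: eq_bigr => l _; rewrite mxE.
    rewrite (der_sum D) => [|l]; last exact: cdiffZ.
    apply: eq_bigr => l _; rewrite (derZ D) // cD_wirtinger // big_distrr /=.
    by [].
  rewrite -/(nabla om i b (fun=> delta_mx 0 j) p) nabla_const -row_mul mxE.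
  rewrite !chern_formE // mulmx_suml summxE; apply: eq_bigr => l _.
  rewrite mulmx_sumr summxE; apply: eq_bigr => m _.
  by rewrite -scalemxAl -scalemxAr !mxE mulrA.
have -> : curvature om i p u w j k =
    nabla om i u (nabla om i w (fun=> delta_mx 0 j)) p 0 k -
    nabla om i w (nabla om i u (fun=> delta_mx 0 j)) p 0 k.
  by rewrite /curvature mxE [LHS]mxE [X in _ + X]mxE.
have sub_eq (a b a' b' : C) : a = a' -> b = b' -> a - b = a' - b' by move=> -> ->.
apply: eq_trans (sub_eq _ _ _ _ (first_term u w) (first_term w u)) _.
apply: eq_trans (curvature_20_cancel _ _ _ _ _ _) _; last first.
  by apply: eq_bigr => l _; apply: eq_bigr => m _; congr (_ * _); rewrite mxE.
have mx_sub_eq (A B P Q : 'M[C]_n) a b : A j k = a -> B j k = b ->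
    A - B = P - Q -> a - b = P j k - Q j k.
  by move=> <- <- /matrixP /(_ j k); rewrite !mxE.
move=> l m; exact: mx_sub_eq (der_mxE _ _ _ _) (der_mxE _ _ _ _) (dz_christoffel l m Up).
Qed.
End Curvature.

(** Contracting the (1,1)-curvature on the form indices agrees with contracting
    it on the endomorphism indices. *)
Lemma contraction_identity (F : comNzRingType) n (G : 'M[F]_n) (E Eb : 'I_n -> 'M[F]_n)
    (K L : 'I_n -> 'I_n -> 'M[F]_n) j k :
  (forall l a c, E l a c = E a l c) -> (forall m e d, Eb m e d = Eb d e m) ->
  (forall m l a d, K m l a d = L a d l m) ->
  \sum_l \sum_m - (K m l *m G - E l *m G *m Eb m *m G) j k * G m l =
  ((\matrix_(a, d) - (\tr (L a d *m G) - \tr (Eb d *m G *m E a *m G))) *m G) j k.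
Proof.
move=> Esym Ebsym KL; rewrite mxE.
transitivity (\sum_d (- \sum_l \sum_m (K m l - E l *m G *m Eb m) j d * G m l) * G d k).
  under [RHS]eq_bigr => d _ do rewrite mulNr big_distrl -sumrN /=.
  rewrite [RHS]exchange_big; apply: eq_bigr => l _ /=.
  under [RHS]eq_bigr => d _ do rewrite big_distrl -sumrN /=.
  rewrite [RHS]exchange_big; apply: eq_bigr => m _ /=.
  rewrite -mulmxBl mxE mulNr big_distrl -sumrN; apply: eq_bigr => d _ /=.
  by rewrite mulrAC.
apply: eq_bigr => d _; congr (_ * _); rewrite mxE; congr (- _).
have swap l m : (E l *m G *m Eb m) j d = (E j *m G *m Eb d) l m.
  rewrite !mxE; apply: eq_bigr => e _; rewrite !mxE Ebsym; congr (_ * _).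
  by apply: eq_bigr => c _; rewrite Esym.
rewrite -[Eb d *m G *m E j *m G]mulmxA [X in _ - X]mxtrace_mulC mulmxA /mxtrace -sumrB.
apply: eq_bigr => l _.
rewrite [X in _ = X - _]mxE [X in _ = _ - X]mxE -sumrB; apply: eq_bigr => m _.
by rewrite -mulrBl -KL -swap [in LHS]mxE [X in (_ + X) * _]mxE.
Qed.

(** * The Ricci form *)

Section Ricci.
Variables (R : realType) (n : nat) (X : complexManifold R n).
Variables (om : kahlerForm X) (i : chart_index X).
Local Notation C := R[i].
Local Notation V := (model R n).
Local Notation U := (chart_img i).
Local Notation H := (gram om i).
Local Notation G := (gram_inv om i).
Implicit Types (p q u w x : V).

Local Opaque dz dzb cD gram.

Definition log_det q : C := (ln (complex.Re (\det (H q))))%:C.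

(** The Ricci form is i / 2 pi times the (1,1)-form with these coefficients. *)
Definition ricci_mx p : 'M[C]_n := \matrix_(j, d) - dz j (dzb d log_det) p.

Lemma det_gram_real q : U q -> (complex.Re (\det (H q)))%:C = \det (H q).
Proof.
move=> Uq; have := det_gram_gt0 om Uq; rewrite ltcE => /andP [/eqP im0 _].
by apply: complex_eq => //=; rewrite im0.
Qed.

(** Jacobi's formula for the logarithm of the determinant. *)
Lemma dzb_log_det d q : U q -> dzb d log_det q = \tr (dzbH om i d q *m G q).
Proof.
move=> Uq; have D := derivation_dzb d q.
have det_gt0 : 0 < complex.Re (\det (H q)).
  by have := det_gram_gt0 om Uq; rewrite ltcE => /andP [].
have dH := cdiff_mx_gram om Uq.
have [dRe _] := cdiff_det dH.
have dln := is_derive1_ln det_gt0.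
apply: eq_trans (der_chain1 D dRe _) _.
  by apply/derivable1_diffP; apply: ex_derive.
rewrite derive1E derive_val.
have -> : ((complex.Re (\det (H q)))^-1)%:C = (\det (H q))^-1.
  by rewrite -[in RHS]det_gram_real //; exact: fmorphV.
have -> : dzb d (fun q0 => (complex.Re (\det (H q0)))%:C) q = dzb d (fun q0 => \det (H q0)) q.
  by apply: (der_near D); apply: filterS (nearU Uq) => q' Uq'; rewrite det_gram_real.
rewrite (der_det D dH) -mxtraceZ scalemxAr.
by [].
Qed.

Lemma der_trace p d m (M : V -> 'M[C]_m) : derivation_at p d -> cdiff_mx p M ->
  d (fun q => \tr (M q)) = \tr (der_mx d M).
Proof.
move=> D dM; apply: eq_trans (der_sum D _ _) _ => [j|]; first exact: dM.
by apply: eq_bigr => j _; rewrite der_mxE.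
Qed.

Lemma ricci_mxE p j d : U p -> ricci_mx p j d =
  - (\tr (der_mx (fun f => dz j f p) (dzbH om i d) *m G p)
     - \tr (dzbH om i d p *m G p *m dzH om i j p *m G p)).
Proof.
move=> Up; rewrite mxE; congr (- _); have D := derivation_dz j p.
have dB := cdiff_mx_dzbH om d Up; have dG := cdiff_mx_gram_inv om Up.
apply: (@eq_trans _ _ (dz j (fun q => \tr (dzbH om i d q *m G q)) p)).
  by apply: (der_near D); apply: filterS (nearU Up) => q Uq; exact: dzb_log_det.
apply: eq_trans (der_trace D (cdiff_mulmx dB dG)) _.
apply: eq_trans (congr1 mxtrace (der_mulmx D dB dG)) _.
rewrite mxtraceD; congr (_ + _).
apply: eq_trans (congr1 mxtrace (congr1 (mulmx (dzbH om i d p)) (der_gram_inv om Up D))) _.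
by rewrite mulmxN raddfN /= !mulmxA.
Qed.

(** Both sides are contractions of the same curvature tensor, on the two indices
    of the 2-form and on the two indices of the endomorphism respectively. *)
Lemma contracted_curvatureE p : U p ->
  'i *: contracted_curvature om i p = ricci_mx p *m G p.
Proof.
move=> Up; apply/matrixP => j k.
pose rho := \matrix_(l, m) (- dzb m (fun q => christoffel om i l q j k) p) : 'M[C]_n.
have -> : ('i *: contracted_curvature om i p) j k = \sum_l \sum_m rho l m * G p m l.
  rewrite mxE [contracted_curvature _ _ _ _ _]mxE.
  have := @Lambda_contr_form11 R n (H p) (G p) rho (omC om i p) (fun u w => curvature om i p u w j k) (gram_mulVl om Up).
  move=> /(_ (fun u w => kf_form11 om Up u w) (fun u w => curvature_form11 om u w j k Up)) ->.
  by rewrite mulrA mulrN mulii opprK mul1r.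
pose K m l := der_mx (fun f => dzb m f p) (dzH om i l).
pose L a d := der_mx (fun f => dz a f p) (dzbH om i d).
have KE m l a b : K m l a b = dzb m (dz l (fun q => H q a b)) p.
  by rewrite /K der_mxE; congr (dzb m _ p); apply/funext => q; exact: mxE.
have LE m l a b : L m l a b = dz m (dzb l (fun q => H q a b)) p.
  by rewrite /L der_mxE; congr (dz m _ p); apply/funext => q; exact: mxE.
have rhoE l m : rho l m =
    - (K m l *m G p - dzH om i l p *m G p *m dzbH om i m p *m G p) j k.
  rewrite mxE; congr (- _); have D := derivation_dzb m p.
  have dA := cdiff_mx_dzH om l Up; have dG := cdiff_mx_gram_inv om Up.
  have e : der_mx (fun f => dzb m f p) (christoffel om i l) =
      K m l *m G p - dzH om i l p *m G p *m dzbH om i m p *m G p.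
    apply: eq_trans (der_mulmx D dA dG) _; congr (_ + _).
    apply: eq_trans (congr1 (mulmx (dzH om i l p)) (der_gram_inv om Up D)) _.
    by rewrite mulmxN !mulmxA.
  exact: eq_trans (esym (der_mxE _ _ _ _)) (congr1 (fun M : 'M[C]_n => M j k) e).
transitivity (\sum_l \sum_m - (K m l *m G p
    - dzH om i l p *m G p *m dzbH om i m p *m G p) j k * G p m l).
  by apply: eq_bigr => l _; apply: eq_bigr => m _; congr (_ * _); exact: rhoE.
apply: eq_trans (@contraction_identity _ _ (G p) (fun l => dzH om i l p)
  (fun m => dzbH om i m p) K L j k _ _ _) _.
- move=> l a c; apply: eq_trans (@dzHE _ _ _ _ _ _ _ _ _) (eq_trans _ (esym (@dzHE _ _ _ _ _ _ _ _ _))).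
  exact: dz_gram_sym.
- move=> m e d; apply: eq_trans (@dzbHE _ _ _ _ _ _ _ _ _) (eq_trans _ (esym (@dzbHE _ _ _ _ _ _ _ _ _))).
  exact: dzb_gram_sym.
- move=> m l a d; apply: eq_trans (KE _ _ _ _) (eq_trans _ (esym (LE _ _ _ _))).
  exact: gram_hess_sym.
congr ((_ *m _) j k); apply/matrixP => a d; rewrite mxE; exact/esym/ricci_mxE.
Qed.
End Ricci.

(** * Fundamental vector fields *)

Section Coordinates.
Variables (R : realType) (n : nat) (V : normedModType R).
Local Notation M := (model R n).

(** Real coordinates: [false] for x_j and [true] for y_j. *)
Definition coord (b : bool) (j : 'I_n) (u : M) : R := if b then u.2 0 j else u.1 0 j.

Lemma derive_linear_comp (W W' : normedModType R) (L : {linear W -> W'}) (F : V -> W) z w :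
  continuous L -> differentiable F z -> 'D_w (L \o F) z = L ('D_w F z).
Proof.
move=> cL dF; have dL : differentiable L (F z) by exact: linear_differentiable.
rewrite deriveE; last exact: differentiable_comp.
rewrite diff_comp //= diff_lin // deriveE //.
Qed.

Lemma differentiable_coord_comp (F : V -> M) z b j :
  differentiable F z -> differentiable (fun x => coord b j (F x)) z.
Proof.
move=> dF; rewrite /coord; case: b.
  apply: (@differentiable_comp _ _ _ _ (fun x => (F x).2) (fun v : 'rV[R]_n => v 0 j)).
    apply: (@differentiable_comp _ _ _ _ F (fun u : M => u.2)) => //.
    by apply: linear_differentiable => x; exact: cvg_snd.
  exact: differentiable_coord.
apply: (@differentiable_comp _ _ _ _ (fun x => (F x).1) (fun v : 'rV[R]_n => v 0 j)).
  apply: (@differentiable_comp _ _ _ _ F (fun u : M => u.1)) => //.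
  by apply: linear_differentiable => x; exact: cvg_fst.
exact: differentiable_coord.
Qed.

Lemma derive_coord (F : V -> M) z w b j : differentiable F z ->
  'D_w (fun x => coord b j (F x)) z = coord b j ('D_w F z).
Proof.
move=> dF; rewrite /coord; case: b.
  have c2 : continuous (snd : M -> 'rV[R]_n) by move=> x; exact: cvg_snd.
  rewrite -[('D_w F z).2](derive_linear_comp w c2 dF) derive_mx ?mxE //.
  apply: diff_derivable; apply: differentiable_comp => //.
  exact: linear_differentiable.
have c1 : continuous (fst : M -> 'rV[R]_n) by move=> x; exact: cvg_fst.
rewrite -[('D_w F z).1](derive_linear_comp w c1 dF) derive_mx ?mxE //.
apply: diff_derivable; apply: differentiable_comp => //.
exact: linear_differentiable.
Qed.

Lemma coord_Jop j u : coord false j (Jop u) = - coord true j u.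
Proof. by rewrite /coord /= mxE. Qed.

Lemma coord_JopT j u : coord true j (Jop u) = coord false j u.
Proof. by []. Qed.
End Coordinates.

Lemma derive_slice (R : realType) (V1 V2 W : normedModType R) (F : V1 * V2 -> W) t q u :
  'D_(0, u) F (t, q) = 'D_u (fun x => F (t, x)) q.
Proof.
rewrite /derive; set d := (fun _ : R => _); set d' := (fun _ : R => _).
suff -> : d = d' by []; apply/funext => h; rewrite /d /d' /=.
congr (_ *: (F _ - _)); transitivity ((h *: (0 : V1) + t, h *: u + q)) => //.
by rewrite scaler0 add0r.
Qed.

Section Action.
Variables (R : realType) (n r : nat) (X : complexManifold R n).
Variables (T : torusAction r X) (i : chart_index X).
Hypothesis T_holomorphic : holomorphic_action T.
Local Notation M := (model R n).
Local Notation P := ('rV[R]_r * M)%type.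
Local Notation U := (chart_img i).

Definition flow (z : P) : M := chart_map i (T z.1 (chart_inv i z.2)).
Definition flow_dom : set P := [set z | U z.2 /\ chart_dom i (T z.1 (chart_inv i z.2))].

Lemma chart_inv_dom p : U p -> chart_dom i (chart_inv i p).
Proof. by move=> [x xi <-]; rewrite chart_mapK. Qed.

Lemma flow_dom0 p : U p -> flow_dom (0, p).
Proof. by move=> Up; split=> //=; rewrite torus_act0; exact: chart_inv_dom. Qed.

(** The local flow is defined on an open set, so derivatives see all its values. *)
Lemma near_flow_dom z : flow_dom z -> \forall z' \near z, flow_dom z'.
Proof.
move=> [Uz Dz].
have cinv : {for z.2, continuous (chart_inv i)}.
  have := @chart_inv_continuous _ _ X i; rewrite continuous_open_subspace.
    by apply; rewrite inE.
  exact: chart_img_open.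
have c2 : (snd : P -> M) @ z --> z.2 by exact: cvg_snd.
have c : (fun z' : P => T z'.1 (chart_inv i z'.2)) @ z --> T z.1 (chart_inv i z.2).
  have cp : (fun z' : P => (z'.1, chart_inv i z'.2)) @ z --> (z.1, chart_inv i z.2).
    apply: (@cvg_pair _ _ _ (nbhs z) (nbhs z.1) (nbhs (chart_inv i z.2)) _ _ _ fst (fun z' => chart_inv i z'.2)).
      exact: cvg_fst.
    exact: (cvg_comp snd (chart_inv i) c2 cinv).
  exact: (cvg_comp _ _ cp (@torus_act_continuous _ _ _ _ T (z.1, chart_inv i z.2))).
have nU : \forall z' \near z, U z'.2.
  by apply: (c2 U); exact: nearU.
have nD : \forall z' \near z, chart_dom i (T z'.1 (chart_inv i z'.2)).
  by apply: (c (chart_dom i)); apply: open_nbhs_nbhs; split=> //; exact: chart_dom_open.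
by apply: filterS2 nU nD => z' ? ?; split.
Qed.

Lemma flow_differentiable z : flow_dom z -> differentiable flow z.
Proof. by move=> Wz; have [+ _] := torus_act_smooth T i i 1; apply. Qed.

Lemma flow_differentiable2 w z : flow_dom z -> differentiable ('D_w flow) z.
Proof.
by move=> Wz; have [_ /(_ w) [+ _]] := torus_act_smooth T i i 2; apply.
Qed.

Lemma near_flow_differentiable z : flow_dom z -> \forall z' \near z, differentiable flow z'.
Proof.
by move=> /near_flow_dom; apply: filterS => z'; exact: flow_differentiable.
Qed.

Lemma flow_holomorphic u z : flow_dom z -> 'D_(0, Jop u) flow z = Jop ('D_(0, u) flow z).
Proof.
case: z => t q [Uq Dq]; rewrite !derive_slice.
by have [_] := T_holomorphic t i i; apply.
Qed.

Lemma fundamentalE xi q : fundamental T xi i q = 'D_(xi, 0) flow (0, q).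
Proof.
have e : (fun h : R => h^-1 *: (chart_map i (T ((h + 0) *: xi) (chart_inv i q))
      - chart_map i (T (0 *: xi) (chart_inv i q)))) =
    (fun h : R => h^-1 *: (flow (h *: ((xi, 0) : P) + (0, q)) - flow (0, q))).
  apply/funext => h; congr (_ *: (_ - _)); rewrite /flow /=.
    by rewrite !addr0 scaler0 add0r.
  by rewrite scale0r.
by rewrite /fundamental /derive1 /derive -e.
Qed.

(** Schwarz's theorem lets the time derivative that defines the field come last,
    where holomorphy of each map of the flow can be used. *)
Lemma derive_fundamental xi u p b j : U p ->
  'D_u (fun q => coord b j (fundamental T xi i q)) p =
  coord b j ('D_(xi, 0) ('D_(0, u) flow) (0, p)).
Proof.
move=> Up; have W0 := flow_dom0 Up.
have near_coord w : \forall z \near ((0, p) : P),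
    coord b j ('D_w flow z) = 'D_w (fun z => coord b j (flow z)) z.
  by apply: filterS (near_flow_differentiable W0) => z dz; exact/esym/derive_coord.
have D2 w : differentiable ('D_w (fun z => coord b j (flow z))) (0, p).
  apply: differentiable_near (near_coord w) _.
  exact/differentiable_coord_comp/flow_differentiable2.
have near_D : \forall z \near ((0, p) : P), differentiable (fun z => coord b j (flow z)) z.
  apply: filterS (near_flow_differentiable W0) => z dz.
  exact: differentiable_coord_comp.
apply: (@eq_trans _ _ ('D_(0, u) (fun z => coord b j ('D_(xi, 0) flow z)) (0, p))).
  pose a (z : P) := coord b j ('D_(xi, 0) flow z).
  have e : 'D_((0, u) : P) a ((0, p) : P) = 'D_u (fun q => a (0, q)) p by exact: derive_slice.
  apply: eq_trans _ (esym e).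
  have e2 : (fun q => coord b j (fundamental T xi i q)) = (fun q => a (0, q)).
    by apply/funext => q; rewrite fundamentalE.
  exact: (congr1 (fun g : M -> R => 'D_u g p) e2).
apply: eq_trans (near_eq_derive _ (near_coord (xi, 0))) _.
apply: eq_trans (schwarz near_D (D2 _) (D2 _)) _.
apply: eq_trans (esym (near_eq_derive _ (near_coord (0, u)))) _.
by apply: derive_coord; exact: flow_differentiable2.
Qed.

Lemma fundamental_holomorphic xi u p b j : U p ->
  'D_(Jop u) (fun q => coord b j (fundamental T xi i q)) p =
  coord b j (Jop ('D_(xi, 0) ('D_(0, u) flow) (0, p))).
Proof.
move=> Up; have W0 := flow_dom0 Up; rewrite derive_fundamental //.
rewrite -derive_coord; last exact: flow_differentiable2.
have cE c k : 'D_(xi, 0) (fun z => coord c k ('D_(0, u) flow z)) (0, p) =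
    coord c k ('D_(xi, 0) ('D_(0, u) flow) (0, p)).
  by apply: derive_coord; exact: flow_differentiable2.
case: b.
  rewrite coord_JopT -cE; apply: near_eq_derive.
  by apply: filterS (near_flow_dom W0) => z Wz; rewrite flow_holomorphic.
rewrite coord_Jop -cE -deriveN; last first.
  by apply/diff_derivable/differentiable_coord_comp; exact: flow_differentiable2.
apply: near_eq_derive; apply: filterS (near_flow_dom W0) => z Wz.
by rewrite flow_holomorphic // coord_Jop.
Qed.

Lemma phi_coord xi q j : phi T xi i q 0 j =
  coord false j (fundamental T xi i q) +i* coord true j (fundamental T xi i q).
Proof. exact: mxE. Qed.

(** Each map of the action is holomorphic, and the derivative in time commutes
    with the derivatives in space. *)
Lemma phi_holomorphic xi p j k : U p -> dzb k (fun q => phi T xi i q 0 j) p = 0.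
Proof.
move=> Up; have cDphi u : cD u (fun q => phi T xi i q 0 j) p =
   ('D_u (fun q => coord false j (fundamental T xi i q)) p) +i*
   ('D_u (fun q => coord true j (fundamental T xi i q)) p).
  by rewrite /cD; congr (_ +i* _); congr ('D_u _ p); apply/funext => q; rewrite phi_coord.
rewrite /dzb !cDphi -[ddy R k]Jop_ddx !fundamental_holomorphic // !derive_fundamental //.
rewrite coord_Jop coord_JopT.
have rot (a b : R) : a +i* b + 'i * (- b +i* a) = 0 :> R[i].
  have -> : 'i = 0 +i* 1 :> R[i] by [].
  apply: complex_eq; rewrite ?(ReD, ImD, ReM, ImM) /=.
    by rewrite mul0r mul1r sub0r subrr.
  by rewrite mul0r mul1r add0r subrr.
by rewrite rot mulr0.
Qed.

Lemma cdiff_phi xi p j : U p -> cdiff (fun q => phi T xi i q 0 j) p.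
Proof.
move=> Up; have df b : differentiable (fun q => coord b j (fundamental T xi i q)) p.
  have -> : (fun q => coord b j (fundamental T xi i q)) =
      (fun z => coord b j ('D_(xi, 0) flow z)) \o (fun q : M => ((0, q) : P)).
    by apply/funext => q /=; rewrite fundamentalE.
  apply: differentiable_comp.
    by apply: differentiable_pair => //; exact: differentiable_cst.
  exact/differentiable_coord_comp/flow_differentiable2/flow_dom0.
split; [have := df false|have := df true]; congr (differentiable _ p);
  by apply/funext => q; rewrite phi_coord.
Qed.
End Action.

(** * Coefficients of (1,1)-forms *)

Section Forms.
Variables (R : realType) (n : nat).
Local Notation C := R[i].
Implicit Types (rho : 'M[C]_n) (u w : model R n).

Lemma form11_frame rho j c w : form11 rho (std_frame R (j, c)) w =
  (if c then 'i else 1) * (\sum_m rho j m * conjc (toC w 0 m)) -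
  (if c then - 'i else 1) * (\sum_l rho l j * toC w 0 l).
Proof.
have cb : conjc (if c then 'i else 1) = (if c then - 'i else 1) :> C.
  by case: c; rewrite ?conjci ?conjc1.
have tE l : toC (std_frame R (j, c)) 0 l = (l == j)%:R * (if c then 'i else 1).
  exact: toC_std_frame.
transitivity (\sum_l \sum_m rho l m * (toC (std_frame R (j, c)) 0 l * conjc (toC w 0 m)) -
   \sum_l \sum_m rho l m * (toC w 0 l * conjc (toC (std_frame R (j, c)) 0 m))).
  rewrite -sumrB; apply: eq_bigr => l _; rewrite -sumrB; apply: eq_bigr => m _.
  by rewrite -mulrBr.
congr (_ - _).
  rewrite (bigD1 j) //= [X in _ + X]big1 => [|l lj]; last first.
    by rewrite big1 // => m _; rewrite tE (negbTE lj) !mul0r mulr0.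
  rewrite addr0 big_distrr; apply: eq_bigr => m _ /=.
  by rewrite tE eqxx mul1r mulrCA.
rewrite big_distrr; apply: eq_bigr => l _ /=.
rewrite (bigD1 j) //= big1 => [|m mj]; last first.
  by rewrite tE (negbTE mj) mul0r conjc0 !mulr0.
by rewrite addr0 tE eqxx mul1r cb mulrA mulrC.
Qed.

(** On the real frame, (x_j, x_k) yields rho_jk - rho_kj and (x_j, y_k) yields
    - i (rho_jk + rho_kj). *)
Lemma form11_inj rho : (forall u w, form11 rho u w = 0) -> rho = 0.
Proof.
move=> r0; apply/matrixP => j k; rewrite mxE.
have pick (a : 'I_n -> C) (c : C) (m0 : 'I_n) :
    \sum_m a m * ((m == m0)%:R * c) = a m0 * c.
  rewrite (bigD1 m0) //= eqxx mul1r big1 ?addr0 // => m mm.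
  by rewrite (negbTE mm) mul0r mulr0.
have e b : rho j k * (if b then - 'i else 1) - rho k j * (if b then 'i else 1) = 0.
  have := r0 (std_frame R (j, false)) (std_frame R (k, b)).
  rewrite form11_frame !mul1r => <-; congr (_ - _).
    rewrite -(pick (fun m => rho j m)); apply: eq_bigr => m _; rewrite toC_std_frame /= conjcM conjc_nat.
    by case: b; rewrite ?conjci ?conjc1.
  by rewrite -(pick (fun m => rho m j)); apply: eq_bigr => m _; rewrite toC_std_frame.
have := e true; have := e false; move: (rho j k) (rho k j) => a b.
rewrite !mulr1 => /eqP; rewrite subr_eq0 => /eqP <- /eqP.
rewrite -mulrBr -opprD mulrN oppr_eq0 mulf_eq0 => /orP [/eqP //|].
rewrite -mulr2n mulrn_eq0 /= => /eqP i0; have := mulii R.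
by rewrite i0 mul0r => /eqP; rewrite eq_sym oppr_eq0 oner_eq0.
Qed.

Lemma form11_lin (a b : C) rho rho' u w :
  form11 (a *: rho + b *: rho') u w = a * form11 rho u w + b * form11 rho' u w.
Proof.
rewrite /form11 !big_distrr -big_split; apply: eq_bigr => l _ /=.
rewrite !big_distrr -big_split; apply: eq_bigr => m _ /=.
by rewrite [in LHS]mxE [X in (X + _) * _]mxE [X in (_ + X) * _]mxE mulrDl !mulrA.
Qed.

Lemma ddbar_form11 (f : model R n -> R) p u w : ddbar f p u w =
  form11 (\matrix_(j, k) dz j (dzb k (fun q => (f q)%:C)) p) u w.
Proof.
apply: eq_bigr => j _; apply: eq_bigr => k _; congr (_ * _).
by rewrite mxE.
Qed.
End Forms.

(** * The weight and the moment map *)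

Section LogPotential.
Variables (R : realType) (r : nat) (v : 'rV[R]_r -> R) (O : set 'rV[R]_r).
Hypotheses (openO : open O) (v_smooth : smooth_on O v).

Lemma near_log_potential y : O y -> 0 < v y -> \forall y' \near y, O y' /\ 0 < v y'.
Proof.
move=> Oy vy; have [dv _] := v_smooth 1.
have nO : \forall y' \near y, O y' by exact: open_nbhs_nbhs.
have nv : \forall y' \near y, 0 < v y'.
  have cv := differentiable_continuous (dv _ Oy).
  by apply: (cv [set t | 0 < t]); apply: open_nbhs_nbhs; split=> //; exact: open_gt.
by apply: filterS2 nO nv.
Qed.

Lemma differentiable_log y : O y -> 0 < v y -> differentiable (fun z => ln (v z)) y.
Proof.
move=> Oy vy; have [dv _] := v_smooth 1.
have dln := is_derive1_ln vy.
have dl : differentiable (@ln R) (v y) by apply/derivable1_diffP; apply: ex_derive.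
exact: differentiable_comp (dv _ Oy) dl.
Qed.

Lemma derive_log w y : O y -> 0 < v y -> 'D_w (fun z => ln (v z)) y = (v y)^-1 * 'D_w v y.
Proof.
move=> Oy vy; have [dv _] := v_smooth 1; have dvy := dv _ Oy.
have dln := is_derive1_ln vy.
have dl : differentiable (@ln R) (v y) by apply/derivable1_diffP; apply: ex_derive.
rewrite deriveE; last exact: differentiable_log.
rewrite (diff_comp dvy dl) /= -[X in 'd _ _ X]mulr1 [LHS]linearZ /=.
rewrite -[in LHS]deriveE // -[in LHS]deriveE // derive_val.
by rewrite mulrC.
Qed.

Lemma differentiable_derive_log w y : O y -> 0 < v y ->
  differentiable ('D_w (fun z => ln (v z))) y.
Proof.
move=> Oy vy; have [dv /(_ w) [d2 _]] := v_smooth 2.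
apply: (@differentiable_near _ _ _ (fun z => (v z)^-1 * 'D_w v z)).
  apply: filterS (near_log_potential Oy vy) => z [Oz vz].
  by rewrite derive_log.
apply: differentiableM; last exact: d2.
by apply: differentiableV; [exact: dv|rewrite gt_eqF].
Qed.
End LogPotential.

Section Soliton.
Variables (R : realType) (n r : nat) (X : complexManifold R n).
Variables (om : kahlerForm X) (T : torusAction r X) (mu : X -> 'rV[R]_r).
Variables (v : 'rV[R]_r -> R) (i : chart_index X).
Hypothesis mu_moment : moment_map om T mu.
Hypothesis v_smooth : smooth_near (moment_polytope mu) v.
Hypothesis v_positive : forall q, moment_polytope mu q -> 0 < v q.
Local Notation C := R[i].
Local Notation V := (model R n).
Local Notation U := (chart_img i).
Local Notation H := (gram om i).
Local Notation G := (gram_inv om i).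
Local Notation log_v := (fun q => ln (v q)).
Implicit Types (p q u w : V).

Local Opaque dz dzb cD gram.

Definition mu_chart q : 'rV[R]_r := mu (chart_inv i q).
Definition xi_chart (a : 'I_r) q : 'rV[C]_n := phi T (unit_vec R a) i q.

Lemma mu_chart_diff q : U q -> differentiable mu_chart q.
Proof. by move=> Uq; have [/(_ i 1) [d _] _] := mu_moment; exact: d. Qed.

Lemma cD_mu u a q : U q -> cD u (fun x => (mu_chart x 0 a)%:C) q =
  'i * form11 (H q) u (fundamental T (unit_vec R a) i q).
Proof.
move=> Uq; rewrite -(kf_form11 om Uq); apply: eq_trans (cDreal _ _ _) _.
congr (_%:C); have [_ <-] // := mu_moment.
congr ('D_u _ q); apply/funext => x; rewrite /pairing /unit_vec (bigD1 a) //=.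
rewrite mxE !eqxx mulr1 big1 ?addr0 // => b ba.
by rewrite mxE (negbTE ba) andbF mulr0.
Qed.

(** From d mu_a = omega(-, xi_a), split by type. *)
Lemma dz_mu j a q : U q -> dz j (fun x => (mu_chart x 0 a)%:C) q =
  'i * \sum_m H q j m * conjc (xi_chart a q 0 m).
Proof.
move=> Uq; set f := fun x => _.
have -> : dz j f q = 2^-1 * (cD (std_frame R (j, false)) f q - 'i * cD (std_frame R (j, true)) f q).
  by [].
rewrite !cD_mu // !form11_frame /=; move: (\sum_(m < n) _) (\sum_(m < n) _) => y x.
transitivity ('i * (2^-1 * ((1 - 'i * 'i) * x - (1 + 'i * 'i) * y))).
  by move: 'i (2^-1) => *; ring.
rewrite mulii subrr mul0r subr0 opprK mulrA mulrA.
by congr (_ * x); rewrite -mulrA mulVf ?mulr1 // pnatr_eq0.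
Qed.

Lemma dzb_mu k a q : U q -> dzb k (fun x => (mu_chart x 0 a)%:C) q =
  - 'i * \sum_l H q l k * xi_chart a q 0 l.
Proof.
move=> Uq; set f := fun x => _.
have -> : dzb k f q = 2^-1 * (cD (std_frame R (k, false)) f q + 'i * cD (std_frame R (k, true)) f q).
  by [].
rewrite !cD_mu // !form11_frame /=; move: (\sum_(m < n) _) (\sum_(m < n) _) => y x.
transitivity (- 'i * (2^-1 * ((1 - 'i * 'i) * y - (1 + 'i * 'i) * x))).
  by move: 'i (2^-1) => *; ring.
rewrite mulii subrr mul0r subr0 opprK mulrA mulrA.
by congr (_ * y); rewrite -mulrA mulVf ?mulr1 // pnatr_eq0.
Qed.

Lemma v_domain : exists W : set 'rV[R]_r,
  [/\ open W, smooth_on W v, forall x, W (mu x) & forall x, 0 < v (mu x)].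
Proof.
have [W [openO muO sv]] := v_smooth; exists W; split => // x.
  by apply: muO; exists x.
by apply: v_positive; exists x.
Qed.

Definition potential q : R := ln (v (mu_chart q)).

Lemma differentiable_logv q : differentiable log_v (mu_chart q).
Proof. by have [W [openO sv mO vp]] := v_domain; exact: (differentiable_log sv (mO (chart_inv i q)) (vp (chart_inv i q))). Qed.

Lemma differentiable_grad a q : differentiable ('D_(unit_vec R a) log_v) (mu_chart q).
Proof.
have [W [openO sv mO vp]] := v_domain.
exact: (differentiable_derive_log openO sv _ (mO (chart_inv i q)) (vp (chart_inv i q))).
Qed.

Lemma dzb_potential k q : U q -> dzb k (fun x => (potential x)%:C) q =
  \sum_a ('D_(unit_vec R a) log_v (mu_chart q))%:C *
     (- 'i * \sum_l H q l k * xi_chart a q 0 l).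
Proof.
move=> Uq; have D := derivation_dzb k q.
apply: eq_trans (der_chain D (mu_chart_diff Uq) (differentiable_logv q)) _.
by apply: eq_bigr => a _; congr (_ * _); exact: dzb_mu.
Qed.

Definition potential_hess p : 'M[C]_n :=
  \matrix_(j, k) dz j (dzb k (fun q => (potential q)%:C)) p.

Lemma cdiff_pair p k a : U p -> cdiff (fun q => \sum_l H q l k * xi_chart a q 0 l) p.
Proof.
move=> Up; apply: cdiff_sum => l _; apply: cdiffM; first exact: cdiff_gram.
exact: cdiff_phi.
Qed.

(** The chain rule through [mu], whose second derivatives follow from those of
    the metric and of the fundamental fields. *)
Lemma potential_hessE p j k : U p -> potential_hess p j k =
  \sum_a ((\sum_b (hess log_v (mu_chart p) b a)%:C *
             ('i * \sum_m H p j m * conjc (xi_chart b p 0 m))) *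
          (- 'i * \sum_l H p l k * xi_chart a p 0 l)
   + (grad log_v (mu_chart p) 0 a)%:C *
     (- 'i * \sum_l (dz j (fun q => H q l k) p * xi_chart a p 0 l
                     + H p l k * dz j (fun q => xi_chart a q 0 l) p))).
Proof.
move=> Up; have D := derivation_dz j p; rewrite mxE.
pose g a q := 'D_(unit_vec R a) log_v (mu_chart q).
pose B a q := - 'i * \sum_l H q l k * xi_chart a q 0 l.
have dB a : cdiff (B a) p by apply: cdiffZ; exact: cdiff_pair.
have dg a : cdiff (fun q => (g a q)%:C) p.
  by apply: cdiff_real; exact: differentiable_comp (mu_chart_diff Up) (differentiable_grad a p).
apply: (@eq_trans _ _ (dz j (fun q => \sum_a (g a q)%:C * B a q) p)).
  by apply: (der_near D); apply: filterS (nearU Up) => q Uq; exact: dzb_potential.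
apply: eq_trans (der_sum D _ _) _ => [a|]; first exact: cdiffM.
apply: eq_bigr => a _; apply: eq_trans (derM D (dg a) (dB a)) _; congr (_ * _ + _ * _).
- apply: eq_trans (der_chain D (mu_chart_diff Up) (differentiable_grad a p)) _.
  apply: eq_bigr => b _; congr (_%:C * _); first by rewrite mxE.
  exact: dz_mu.
- by rewrite mxE.
apply: eq_trans (derZ D _ (cdiff_pair k a Up)) _; congr (_ * _).
have dHx l : cdiff (fun q => H q l k) p by exact: cdiff_gram.
have dx l : cdiff (fun q => xi_chart a q 0 l) p by exact: cdiff_phi.
apply: eq_trans (der_sum D _ _) _ => [l|]; first exact: cdiffM.
by apply: eq_bigr => l _; exact: (derM D (dHx l) (dx l)).
Qed.

Lemma phi_star_phiE a b p j k : U p ->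
  phi_star_phi om T (unit_vec R a) (unit_vec R b) i p j k =
  (\sum_m H p j m * conjc (xi_chart a p 0 m)) * xi_chart b p 0 k.
Proof.
move=> Up; rewrite /phi_star_phi /rank_one mxE mxE; congr (_ * _).
rewrite herm_row // (bigD1 j) //= [X in _ + X]big1 ?addr0 => [|l lj].
  by apply: eq_bigr => m _; rewrite mxE !eqxx mul1r mulrC.
by rewrite big1 // => m _; rewrite mxE (negbTE lj) andbF !mul0r.
Qed.

(** In the coordinate frame the Lie derivative of a constant field only sees the
    derivative of the fundamental field. *)
Lemma PhiE a p j k : U p -> Phi om T (unit_vec R a) i p j k =
  \sum_l xi_chart a p 0 l * christoffel om i l p j k
  + dz j (fun q => xi_chart a q 0 k) p.
Proof.
move=> Up; rewrite /Phi /connection_moment mxE.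
set xi := fundamental T (unit_vec R a) i.
have lieE : lie_derivative xi (fun=> delta_mx 0 j) p 0 k =
    - dz j (fun q => xi_chart a q 0 k) p.
  rewrite /lie_derivative mxE [X in X + _]mxE (der_cst (derivation_cD _ p)) add0r.
  rewrite [LHS]mxE; congr (- _); rewrite mxE (bigD1 j) //= mxE !eqxx mul1r big1 ?addr0 //.
  by move=> l lj; rewrite mxE (negbTE lj) andbF mul0r.
transitivity (nabla om i (xi p) (fun=> delta_mx 0 j) p 0 k -
   lie_derivative xi (fun=> delta_mx 0 j) p 0 k).
  by rewrite mxE; congr (_ + _); rewrite mxE.
rewrite lieE opprK; congr (_ + _).
rewrite nabla_const mxE chern_formE // summxE; apply: eq_bigr => l _.
by rewrite mxE.
Qed.

(** The second derivatives of [mu] produce the moment map of the curvature: by the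
    Kaehler identity d_j d(conj z)_k mu_a, with the last index raised, is - i Phi_a.
    The products of first derivatives produce phi^* (x) phi. *)
Lemma potential_hess_mulG p : U p ->
  potential_hess p *m G p =
  \sum_a \sum_b (hess log_v (mu_chart p) a b)%:C *:
     phi_star_phi om T (unit_vec R a) (unit_vec R b) i p
  - 'i *: \sum_a (grad log_v (mu_chart p) 0 a)%:C *: Phi om T (unit_vec R a) i p.
Proof.
move=> Up; apply/matrixP => j c; rewrite mxE.
have HG l : \sum_k H p l k * G p k c = (l == c)%:R.
  by have /matrixP /(_ l c) := gram_mulV om Up; rewrite !mxE.
pose x a l := xi_chart a p 0 l; pose dx a l := dz j (fun q => xi_chart a q 0 l) p.
have contract (y : 'I_n -> C) : \sum_k (\sum_l H p l k * y l) * G p k c = y c.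
  transitivity (\sum_l y l * (l == c)%:R).
    under eq_bigr => k _ do rewrite big_distrl /=.
    rewrite exchange_big; apply: eq_bigr => l _ /=.
    rewrite -HG big_distrr; apply: eq_bigr => k _ /=.
    by rewrite mulrA [y l * _]mulrC.
  rewrite (bigD1 c) //= eqxx mulr1 big1 ?addr0 // => l lc.
  by rewrite (negbTE lc) mulr0.
have Phi_contract a : \sum_k (\sum_l (dz j (fun q => H q l k) p * x a l + H p l k * dx a l)) * G p k c
    = Phi om T (unit_vec R a) i p j c.
  rewrite PhiE // -[dz j _ p](contract (dx a)).
  rewrite [RHS](_ : _ = \sum_k ((\sum_l dz j (fun q => H q l k) p * x a l) * G p k c
     + (\sum_l H p l k * dx a l) * G p k c)).
    by apply: eq_bigr => k _; rewrite -mulrDl big_split.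
  rewrite big_split; congr (_ + _).
  under [RHS]eq_bigr => k _ do rewrite big_distrl /=.
  rewrite [RHS]exchange_big; apply: eq_bigr => l _ /=.
  have -> : christoffel om i l p j c = \sum_k dzH om i l p j k * G p k c by exact: mxE.
  rewrite big_distrr; apply: eq_bigr => k _ /=.
  have -> : dzH om i l p j k = dz j (fun q => H q l k) p.
    by apply: eq_trans (dzHE _ _ _ _ _ _) _; exact: dz_gram_sym.
  by rewrite mulrA [_ * x a l]mulrC.
pose eta b := \sum_m H p j m * conjc (xi_chart b p 0 m).
transitivity (\sum_a ((\sum_b (hess log_v (mu_chart p) b a)%:C * ('i * eta b)) * (- 'i * x a c)
   + (grad log_v (mu_chart p) 0 a)%:C * (- 'i * Phi om T (unit_vec R a) i p j c))).
  have step (S g : 'I_r -> C) (A B : 'I_r -> 'I_n -> C) (y : 'I_n -> C) :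
      \sum_k (\sum_a (S a * (- 'i * A a k) + g a * (- 'i * B a k))) * y k =
      \sum_a (S a * (- 'i * \sum_k A a k * y k) + g a * (- 'i * \sum_k B a k * y k)).
    under eq_bigr => k _ do rewrite big_distrl /=.
    rewrite exchange_big; apply: eq_bigr => a _ /=.
    rewrite !big_distrr -big_split; apply: eq_bigr => k _ /=.
    by rewrite mulrDl !mulrA.
  under eq_bigr => k _ do rewrite potential_hessE //.
  apply: eq_trans (step _ _ _ _ _) _; apply: eq_bigr => a _.
  congr (_ * (_ * _) + _ * (_ * _)); first exact: contract.
  exact: Phi_contract.
rewrite big_split /= [RHS]mxE; congr (_ + _).
  rewrite summxE; under [RHS]eq_bigr => a _ do rewrite summxE.
  rewrite [RHS]exchange_big; apply: eq_bigr => a _ /=.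
  rewrite big_distrl; apply: eq_bigr => b _ /=.
  rewrite [RHS]mxE phi_star_phiE // -mulrA; congr (_ * _).
  by rewrite mulrACA mulrN mulii opprK mul1r.
rewrite [RHS]mxE [X in _ = - X]mxE summxE big_distrr -sumrN; apply: eq_bigr => a _ /=.
by rewrite [in RHS]mxE mulNr mulrN mulrCA.
Qed.

(** The soliton equation between forms, read on coefficients and divided by
    i / 2 pi. *)
Lemma soliton_ricci_mx p : v_soliton om mu v -> U p ->
  ricci_mx om i p = (2 * pi)%:C *: H p + potential_hess p.
Proof.
move=> soliton Up; set k := 'i / (2 * pi)%:C : C.
have pi_neq0 : (2 * pi)%:C != 0 :> C.
  by rewrite (inj_eq (@complexI R)) gt_eqF // mulr_gt0 // pi_gt0.
have k0 : k != 0.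
  rewrite mulf_neq0 ?invr_eq0 //; apply/eqP => i0; have := mulii R.
  by rewrite i0 mul0r => /eqP; rewrite eq_sym oppr_eq0 oner_eq0.
have E : 1 *: (k *: ricci_mx om i p + (- 'i) *: H p) + (- k) *: potential_hess p = 0.
  apply: form11_inj => u w; rewrite !form11_lin mul1r.
  have := soliton i p u w Up; rewrite (kf_form11 om Up).
  have -> : ricci om i p u w = k * form11 (ricci_mx om i p) u w.
    have -> : ricci om i p u w = - k * ddbar (fun q => ln (complex.Re (\det (H q)))) p u w.
      by [].
    rewrite ddbar_form11 mulNr -mulrN; congr (_ * _).
    rewrite /form11 -sumrN; apply: eq_bigr => j _; rewrite -sumrN; apply: eq_bigr => l _.
    rewrite -mulNr; congr (_ * _).
    by apply: eq_trans (congr1 -%R (mxE _ _ _ _)) _; apply: esym; exact: mxE.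
  have -> : ddbar (fun q => ln (v (mu (chart_inv i q)))) p u w =
      form11 (potential_hess p) u w by rewrite ddbar_form11.
  by move=> e; rewrite mulNr e mulNr subrr.
move: E; rewrite scale1r !scaleNr => /eqP; rewrite subr_eq0 subr_eq => /eqP E.
have kE : k * (2 * pi)%:C = 'i by exact: divfK.
by apply: (scalerI k0); rewrite E scalerDr scalerA kE; exact: addrC.
Qed.
End Soliton.

Theorem lemma3p2 (R : realType) (n r : nat) (X : complexManifold R n)
  (compactX : compact [set: X])
  (om : kahlerForm X)
  (T : torusAction r X)
  (T_holomorphic : holomorphic_action T)
  (T_isometric : isometric_action om T)
  (mu : X -> 'rV[R]_r)
  (mu_moment : moment_map om T mu)
  (v : 'rV[R]_r -> R)
  (v_smooth : smooth_near (moment_polytope mu) v)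
  (v_positive : forall q, moment_polytope mu q -> 0 < v q)
  (soliton : v_soliton om mu v) :
  (forall (xi : 'rV[R]_r) (i : chart_index X) (p : model R n) (j k : 'I_n),
     chart_img i p -> dzb k (fun q => phi T xi i q 0 j) p = 0)
  /\
  (forall (i : chart_index X) (p : model R n), chart_img i p ->
     let q := mu (chart_inv i p) in
     let log_v := fun q' => ln (v q') in
     'i *: (contracted_curvature om i p
            + \sum_(a < r) (grad log_v q 0 a)%:C *: Phi om T (unit_vec R a) i p)
     - \sum_(a < r) \sum_(b < r)
         (hess log_v q a b)%:C *: phi_star_phi om T (unit_vec R a) (unit_vec R b) i p
     = (2 * pi)%:C%:M).
Proof.
split=> [xi i p j k Up|i p Up q log_v].
  exact: phi_holomorphic.
have pE : q = mu_chart mu i p by [].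
rewrite scalerDr contracted_curvatureE // (soliton_ricci_mx soliton Up).
rewrite mulmxDl -scalemxAl gram_mulV // (potential_hess_mulG mu_moment v_smooth v_positive Up).
rewrite -pE -/log_v; set A := \sum_(a < r) \sum_(b < r) _; set B := 'i *: _.
by rewrite addrA subrK addrK scalemx1.
Qed.
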